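(* Let $\mathcal H=\mathbb C^d$, $\mathcal K=\mathbb C^k$, and let $[V]\in\mathscr P^{\rm irr}$, with period $p_{[V]}$ and periodic dimensions $d_0([V]),\dots,d_{p_{[V]}-1}([V])$. Then $[V]\in\mathscr P_{p_{[V]},l_{[V]}}$, where $$l_{[V]}=2\left(\sum_{a=0}^{p_{[V]}-1}\left[d_{a\oplus1}([V])\,k-d_a([V])\right]d_a([V])\right)\le2d^2(k-1)=d_{\rm id}.$$ Moreover, for every representative $V\in[V]$ one has $$T_{[V]}(\mathscr P_{p_{[V]},l_{[V]}})\simeq\{A\in T_V^{\rm id}:\ AP_a(V)=(P_{a\oplus1}(V)\otimes\mathbf 1_{\mathcal K})A,\ a=0,\dots,p_{[V]}-1\},$$ where the $P_a(V)$ are the orthogonal projections onto the subspaces of the periodic decomposition of $\mathcal H$. Finally, if two points $[V]$ and $[W]$ belong to the same connected component of any singular manifold $\mathscr P_l$ for some $l$, then $p_{[V]}=p_{[W]}$ and $d_a([V])=d_a([W])$ for every $a=0,\dots,p_{[V]}-1$.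
   Context: For an isometry $V:\mathcal H\to\mathcal H\otimes\mathcal K$ the channel is $\mathcal T_V(X)=V^*(X\otimes\mathbf 1_{\mathcal K})V$, with predual $\mathcal T_{V*}(\rho)={\rm Tr}_{\mathcal K}(V\rho V^* )$; it is irreducible if there is a unique state $\rho_V^{\rm ss}>0$ with $\mathcal T_{V*}(\rho_V^{\rm ss})=\rho_V^{\rm ss}$. $\mathscr V^{\rm irr}$ is the manifold of isometries with irreducible channel. For $V\in\mathscr V^{\rm irr}$ the modulus-one eigenvalues of $\mathcal T_V$ are $\gamma_V^j$, $j=0,\dots,p_V-1$, with $\gamma_V=e^{2\pi i/p_V}$ ($p_V$ is the period), all algebraically simple. The periodic decomposition is $\mathcal H=\bigoplus_{a=0}^{p_V-1}\mathcal H_a$, with $P_a(V)$ the orthogonal projection onto $\mathcal H_a$, such that $\mathcal T_V(P_{a\oplus1}(V))=P_a(V)$ ($\oplus$ is addition mod $p_V$) and $Z_V=\sum_a\gamma_V^aP_a(V)$ is the unitary eigenvector of $\mathcal T_V$ with eigenvalue $\gamma_V$ ($Z_V^j$ being that for $\gamma_V^j$). $V$ is primitive if $p_V=1$. The group $\mathscr G=U(1)\times PU(d)$ acts by $(c,W)\cdot V=\overline c(W\otimes\mathbf 1_{\mathcal K})VW^*$; $[V]$ is the orbit of $V$ and $\mathscr P^{\rm irr}=\mathscr V^{\rm irr}/\mathscr G$ with the quotient topology; $\mathscr P^{\rm prim}\subset\mathscr P^{\rm irr}$ is the set of classes of primitive isometries. The period $p_V$ and the dimensions $(d_0(V),\dots,d_{p_V-1}(V))$,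 $d_a(V)=\dim\mathcal H_a$, do not depend on the representative and are written $p_{[V]}$, $d_a([V])$. The stabiliser of $V$ is $\mathscr G_V=\{(\gamma_V^j,Z_V^j):j=0,\dots,p_V-1\}\simeq\mathbb Z_{p_V}$; its isomorphism class is denoted $\mathscr G_{[V]}$. $T_V^{\rm id}=\{A\in L^\infty(\mathcal H,\mathcal H\otimes\mathcal K):VV^*A=0\}$ is a real linear space of dimension $d_{\rm id}=2d^2(k-1)$, on which $g=(c,W)\in\mathscr G_V$ acts linearly by $A\mapsto\overline c(W\otimes\mathbf 1_{\mathcal K})AW^*$. $\mathscr P^{\rm irr}$ is an orbifold of dimension $d_{\rm id}$, modelled near $[V]$ on a small ball around $0$ in $T_V^{\rm id}$ modulo this action of $\mathscr G_V$. The singular dimension of $[V]$ is the real dimension of the subspace of $T_V^{\rm id}$ fixed by all of $\mathscr G_V$. One sets $$\mathscr P_{p,l}=\{[V]\in\mathscr P^{\rm irr}\setminus\mathscr P^{\rm prim}:\ \mathscr G_{[V]}=\mathbb Z_p\text{ and }[V]\text{ has singular dimension }l\},$$ and the singular manifold $\mathscr P_l$ is the disjoint union over $p$ of the sets $\mathscr P_{p,l}$. Each $\mathscr P_{p,l}$ is an $l$-dimensional manifold whose tangent space $T_{[V]}(\mathscr P_{p,l})$ at $[V]$ is canonically identified with the (isomorphism class of the) $\mathscr G_V$-fixed subspace of $T_V^{\rm id}$.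
   Formalization: Membership in P_{p,l} is asserted only for non-primitive [V], since P_{p,l} excludes primitive classes (all else is asserted for them too); d_a([V]) = d_a([W]) is stated up to a cyclic shift of the labels a, as the labelling is only determined up to such a shift. *)

(* Defs.v *)
From HB Require Import structures.
From mathcomp Require Import all_boot all_order all_algebra.
From mathcomp Require Import complex mxtens.
From mathcomp Require Import all_classical all_reals all_analysis.

Set Implicit Arguments.
Unset Strict Implicit.
Unset Printing Implicit Defensive.

Import Order.TTheory GRing.Theory Num.Theory.
Import numFieldNormedType.Exports.

Local Open Scope classical_set_scope.
Local Open Scope quotient_scope.
Local Open Scope sesquilinear_scope.
Local Open Scope ring_scope.

(* The packaged type selects the library topology on numerical fields, hence
   the product topology on complex matrices. *)
Definition Cplx (R : realType) : numClosedFieldType := R[i]%C.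

(* H = C^d and K = C^k as column vectors; H (x) K = C^(d * k), with basis
   indexed by [mxtens_index (i, m)]; an operator H -> H (x) K is a
   (d * k) x d matrix. *)

Section Channels.
Variables (R : realType) (d k : nat).
Local Notation C := (Cplx R).
Implicit Types (V A : 'M[C]_(d * k, d)) (X W rho : 'M[C]_d).

Definition ampl X : 'M[C]_(d * k) := tensmx X (1%:M : 'M[C]_k).

Definition is_isometry V := V ^t* *m V = 1%:M.

Definition channel V X : 'M[C]_d := V ^t* *m ampl X *m V.

Definition ptraceK (B : 'M[C]_(d * k)) : 'M[C]_d :=
  \matrix_(i, j) \sum_(m < k) B (mxtens_index (i, m)) (mxtens_index (j, m)).

Definition predual V rho : 'M[C]_d := ptraceK (V *m rho *m V ^t*).

(* The order of a complex field is partial: [0 <= z] forces z to be real, so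
   these two conditions include hermitianity. *)
Definition psd rho := forall v : 'cV[C]_d, 0 <= (v ^t* *m rho *m v) 0 0.
Definition posdef rho :=
  forall v : 'cV[C]_d, v != 0 -> 0 < (v ^t* *m rho *m v) 0 0.

Definition is_state rho := psd rho /\ \tr rho = 1.

Definition irreducible V :=
  exists rho, [/\ is_state rho, posdef rho, predual V rho = rho &
    forall sigma, is_state sigma -> predual V sigma = sigma -> sigma = rho].

Definition Virr_set : set 'M[C]_(d * k, d) :=
  [set V | is_isometry V /\ irreducible V].

Definition is_eigenvalue V (z : C) :=
  exists2 X, X != 0 & channel V X = z *: X.

Definition gamma (p : nat) : C :=
  (cos (2 * @pi R / p%:R) +i* sin (2 * @pi R / p%:R))%C.

Definition is_period V (p : nat) :=
  (0 < p)%N /\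
  forall z : C, (`|z| = 1 /\ is_eigenvalue V z) <->
                (exists2 j, (j < p)%N & z = gamma p ^+ j).

(* The junk value 0 is never taken when V is irreducible. *)
Definition period V : nat := xget 0%N [set p | is_period V p].

(* Only the values P a with a < period V matter; a (+) 1 is [a.+1 %% period V].
   The family is determined by V only up to a cyclic relabelling, since Z is
   determined only up to a power of gamma. *)
Definition Zop V (P : nat -> 'M[C]_d) : 'M[C]_d :=
  \sum_(a < period V) gamma (period V) ^+ a *: P a.

Definition periodic_decomposition V (P : nat -> 'M[C]_d) :=
  let p := period V in
  [/\ forall a, (a < p)%N -> (P a) ^t* = P a /\ P a *m P a = P a,
      forall a b, (a < p)%N -> (b < p)%N -> a != b -> P a *m P b = 0,
      \sum_(a < p) P a = 1%:M,
      forall a, (a < p)%N -> channel V (P (a.+1 %% p)%N) = P a &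
      Zop V P \is unitarymx /\ channel V (Zop V P) = gamma p *: Zop V P].

(* Insensitive to the phase of W, so it is an action of U(1) x PU(d). *)
Definition gact (c : C) W A : 'M[C]_(d * k, d) :=
  c^* *: (ampl W *m A *m W ^t*).

Definition orbit_rel V V' :=
  exists (c : C) W, [/\ `|c| = 1, W \is unitarymx & V' = gact c W V].

(* Elements of PU(d) are the cosets U(1) W of unitary matrices W. *)
Definition phase_class W : set 'M[C]_d :=
  [set z *: W | z in [set z : C | `|z| = 1]].

Definition gmul (g h : C * set 'M[C]_d) : C * set 'M[C]_d :=
  (g.1 * h.1, [set X *m Y | X in g.2 & Y in h.2]).

Definition stabiliser V : set (C * set 'M[C]_d) :=
  [set g | exists (c : C) W, [/\ `|c| = 1, W \is unitarymx, gact c W V = V &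
                                 g = (c, phase_class W)]].

(* Z/p is presented as the integers modulo p, which is also right for p = 1. *)
Definition stabiliser_iso_Zmod V (p : nat) :=
  exists f : int -> C * set 'M[C]_d,
    [/\ forall a b, f (a + b) = gmul (f a) (f b),
        forall a b, f a = f b <-> (a = b %[mod p%:Z])%Z &
        range f = stabiliser V].

Definition Tid V : set 'M[C]_(d * k, d) := [set A | V *m V ^t* *m A = 0].

Definition fixed_subspace V : set 'M[C]_(d * k, d) :=
  [set A | Tid V A /\
     forall (c : C) W, `|c| = 1 -> W \is unitarymx -> gact c W V = V ->
                       gact c W A = A].

Definition intertwiners V (P : nat -> 'M[C]_d) : set 'M[C]_(d * k, d) :=
  [set A | Tid V A /\ forall a, (a < period V)%N ->
     A *m P a = ampl (P (a.+1 %% period V)%N) *m A].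

(* In the library, complex matrices form a vector space over R[i] but not over
   R; this says that S is the real span of n vectors independent over R. *)
Definition has_real_dim (S : set 'M[C]_(d * k, d)) (n : nat) :=
  exists b : 'I_n -> 'M[C]_(d * k, d),
    (forall A, S A <-> exists x : 'I_n -> R, A = \sum_i (x i)%:C%C *: b i) /\
    (forall x : 'I_n -> R, \sum_i (x i)%:C%C *: b i = 0 -> forall i, x i = 0).

Definition real_linear_iso (S T : set 'M[C]_(d * k, d)) :=
  exists f : 'M[C]_(d * k, d) -> 'M[C]_(d * k, d),
    [/\ set_bij S T f,
        forall A B, S A -> S B -> f (A + B) = f A + f B &
        forall (x : R) A, S A -> f (x%:C%C *: A) = x%:C%C *: f A].

Lemma amplM X Y : ampl (X *m Y) = ampl X *m ampl Y.
Proof. by rewrite /ampl tensmx_mul mulmx1. Qed.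

Lemma ampl1 : ampl 1%:M = 1%:M.
Proof.
apply/matrixP=> i j; rewrite -(mxtens_unindexK i) -(mxtens_unindexK j).
case: (mxtens_unindex i) => a b; case: (mxtens_unindex j) => a' b'.
rewrite tensmxE !mxE (can_eq (@mxtens_indexK d k)) xpair_eqE.
by case: (a == a'); case: (b == b'); rewrite ?mul1r ?mul0r.
Qed.

Lemma gact1 A : gact 1 1%:M A = A.
Proof. by rewrite /gact ampl1 mul1mx trmx1 map_mx1 mulmx1 conjC1 scale1r. Qed.

Lemma gactM c W c' W' A : gact c W (gact c' W' A) = gact (c * c') (W *m W') A.
Proof.
rewrite /gact amplM trmx_mul map_mxM rmorphM /= -scalerA.
by rewrite -!scalemxAr -!scalemxAl !mulmxA.
Qed.

Lemma orbit_rel_refl V : orbit_rel V V.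
Proof.
exists 1, 1%:M; rewrite normr1 gact1; split=> //.
by apply/unitarymxP; rewrite trmx1 map_mx1 mulmx1.
Qed.

Lemma orbit_rel_sym V V' : orbit_rel V V' -> orbit_rel V' V.
Proof.
case=> c [W [c1 uW ->]]; exists c^*, (W ^t*).
rewrite norm_conjC trmxC_unitary gactM; split=> //.
rewrite -normCKC c1 expr1n -(invmx_unitary uW).
by rewrite mulVmx ?gact1 ?unitarymx_unit.
Qed.

Lemma orbit_rel_trans V1 V2 V3 :
  orbit_rel V1 V2 -> orbit_rel V2 V3 -> orbit_rel V1 V3.
Proof.
case=> c [W [c1 uW ->]] [c' [W' [c1' uW' ->]]].
exists (c' * c), (W' *m W); rewrite normrM c1 c1' mulr1 gactM; split=> //.
exact: mul_unitarymx.
Qed.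

Definition Virr : topologicalType := set_type Virr_set.

Definition mx_of (v : Virr) : 'M[C]_(d * k, d) := \val v.

Definition orbit_relb : rel Virr :=
  fun v w => `[< orbit_rel (mx_of v) (mx_of w) >].

Lemma orbit_relb_equiv : equiv_class_of orbit_relb.
Proof.
split=> [V|V V'|V2 V1 V3].
- exact/asboolP/orbit_rel_refl.
- by apply/asbool_equiv_eq; split; exact: orbit_rel_sym.
- by move=> /asboolP h /asboolP h'; apply/asboolP; exact: orbit_rel_trans h h'.
Qed.

Canonical orbit_equiv := EquivRelPack orbit_relb_equiv.

(* Quotient topology of the subspace topology of [Virr_set]. *)
Definition Pirr : topologicalType := quotient_topology {eq_quot orbit_equiv}.

Definition cls (v : Virr) : Pirr := \pi_({eq_quot orbit_equiv}) v.

Definition Pprim : set Pirr :=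
  [set cls v | v in [set v | period (mx_of v) = 1%N]].

(* Classes of stabiliser Z/p and singular dimension l, primitive or not. *)
Definition orbit_type_stratum (p l : nat) : set Pirr :=
  [set cls v | v in [set v | stabiliser_iso_Zmod (mx_of v) p /\
                             has_real_dim (fixed_subspace (mx_of v)) l]].

Definition singular_stratum (p l : nat) : set Pirr :=
  orbit_type_stratum p l `\` Pprim.

(* Topologised as a subset of [Pirr].  The strata of one dimension l are
   pairwise disjoint. *)
Definition singular_manifold (l : nat) : set Pirr :=
  \bigcup_(p in [set: nat]) singular_stratum p l.

(* The tangent space at a class is only defined up to isomorphism; it is
   realised at the representative selected by the quotient. *)
Definition tangent_space (x : Pirr) : set 'M[C]_(d * k, d) :=
  fixed_subspace (mx_of (repr (x : {eq_quot orbit_equiv}))).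

End Channels.

(* Main.v *)
Require Import Defs.
From HB Require Import structures.
From mathcomp Require Import all_boot all_order all_algebra.
From mathcomp Require Import complex mxtens.
From mathcomp Require Import all_classical all_reals all_analysis.

(* Equality in the Schwarz inequality for the faithful invariant state turns a
   peripheral eigenvector X of T_V, with eigenvalue z, into a relation
   (X (x) 1) V = z V X.  Such X are multiples of unitaries, and for z = 1 they
   are scalar, because X rho X^* is again invariant.  Hence the peripheral
   eigenvalues are simple and form a finite group, the stabiliser of V is that
   group, and the Fourier transform of the powers of Z gives the P_a.

   A tangent vector A is fixed iff (Z (x) 1) A = gamma A Z, that is, iff
   A P_a = (P_(a+1) (x) 1) A for all a.  The complex dimension of this space is
   the trace of the projection A |-> (1 - V V^* ) sum_a (P_(a+1) (x) 1) A P_a.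

   For the last claim, let F(q, r) be the set of those V that have q orthogonal
   projections of ranks r_b with sum 1 and (P_(b+1) (x) 1) V = V P_b.  It is a
   projection of a compact set, hence closed.  An irreducible V in F(q, r) has
   q dividing p_V, and if q < p_V then the operators intertwined by the coarser
   family have a dimension larger than the singular dimension.  So among the
   classes of singular dimension l those with given period and dimensions (up
   to a cyclic shift) form a closed set.  Only finitely many values occur, so
   this set is also open, and it contains every component that it meets. *)

Set Implicit Arguments.
Unset Strict Implicit.
Unset Printing Implicit Defensive.

Import Order.TTheory GRing.Theory Num.Theory.
Import numFieldNormedType.Exports.
Local Open Scope classical_set_scope.
Local Open Scope quotient_scope.
Local Open Scope sesquilinear_scope.
Local Open Scope ring_scope.

(** * Channels, covariant operators and fixed points *)

Section Adjoint.
Variable C : numClosedFieldType.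

Lemma adjmxM m n p (A : 'M[C]_(m, n)) (B : 'M[C]_(n, p)) :
  (A *m B)^t* = B^t* *m A^t*.
Proof. by rewrite trmx_mul map_mxM. Qed.

Lemma adjmxB m n (A B : 'M[C]_(m, n)) : (A - B)^t* = A^t* - B^t*.
Proof. by rewrite linearB /= map_mxB. Qed.

Lemma adjmxZ m n (c : C) (A : 'M[C]_(m, n)) : (c *: A)^t* = c^* *: A^t*.
Proof. by rewrite linearZ /= map_mxZ. Qed.

Lemma adjmx1 n : (1%:M : 'M[C]_n)^t* = 1%:M.
Proof. by rewrite trmx1 map_mx1. Qed.

Lemma adjmx0 m n : (0 : 'M[C]_(m, n))^t* = 0.
Proof. by rewrite trmx0 map_mx0. Qed.

Lemma adjmx_inj m n (A B : 'M[C]_(m, n)) : A^t* = B^t* -> A = B.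
Proof. by move=> e; rewrite -[A]trmxCK e trmxCK. Qed.

Lemma adjmx_sum m n I (r : seq I) (P : pred I) (F : I -> 'M[C]_(m, n)) :
  (\sum_(i <- r | P i) F i)^t* = \sum_(i <- r | P i) (F i)^t*.
Proof. by rewrite !linear_sum /= raddf_sum. Qed.

Lemma adjmx_mulE m n (A : 'M[C]_(m, n)) j :
  (A^t* *m A) j j = \sum_i `|A i j| ^+ 2.
Proof. by rewrite mxE; apply: eq_bigr => i _; rewrite !mxE normCKC. Qed.

Lemma adjmx_mul_eq0 m n (A : 'M[C]_(m, n)) : A^t* *m A = 0 -> A = 0.
Proof.
move=> A0; apply/matrixP => i j; rewrite mxE; apply/eqP.
rewrite -normr_eq0 -sqrf_eq0; apply/eqP.
by have := adjmx_mulE A j; rewrite A0 mxE => /esym/psumr_eq0P -> // l _.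
Qed.

End Adjoint.

Section Covariance.
Variables (R : realType) (d k : nat).
Local Notation C := (Cplx R).
Implicit Types (V A : 'M[C]_(d * k, d)) (X Y Z rho : 'M[C]_d) (z w c : C).

Lemma ampl_is_linear : linear (@ampl R d k).
Proof.
by move=> c X Y; apply/matrixP => i j; rewrite !mxE mulrDl mulrA.
Qed.
HB.instance Definition _ :=
  GRing.isLinear.Build C 'M[C]_d 'M[C]_(d * k) _ (@ampl R d k) ampl_is_linear.

Lemma ampl_adj X : (ampl k X)^t* = ampl k (X^t*).
Proof. by rewrite /ampl trmx_tens map_mxT trmx1 map_mx1. Qed.

Lemma channel_is_linear V : linear (@channel R d k V).
Proof.
move=> c X Y; rewrite /channel linearP mulmxDr mulmxDl.
by rewrite -scalemxAr -scalemxAl.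
Qed.
HB.instance Definition _ V :=
  GRing.isLinear.Build C 'M[C]_d 'M[C]_d _ (@channel R d k V)
    (channel_is_linear V).

Lemma ptraceK_is_linear : linear (@ptraceK R d k).
Proof.
move=> c A B; apply/matrixP => i j; rewrite !mxE big_distrr -big_split /=.
by apply: eq_bigr => m _; rewrite !mxE.
Qed.
HB.instance Definition _ :=
  GRing.isLinear.Build C 'M[C]_(d * k) 'M[C]_d _ (@ptraceK R d k)
    ptraceK_is_linear.

Lemma big_mxtens (F : 'I_(d * k) -> C) :
  \sum_i F i = \sum_(i < d) \sum_(m < k) F (mxtens_index (i, m)).
Proof.
rewrite (reindex (@mxtens_index d k)) /=; last first.
  by exists (@mxtens_unindex d k) => i _;
     rewrite (mxtens_indexK, mxtens_unindexK).
by rewrite pair_big; apply: eq_bigr => -[].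
Qed.

Lemma mul_ampl_mx m X (B : 'M[C]_(d * k, m)) i l j :
  (ampl k X *m B) (mxtens_index (i, l)) j =
  \sum_a X i a * B (mxtens_index (a, l)) j.
Proof.
rewrite mxE big_mxtens; apply: eq_bigr => a _.
rewrite (bigD1 l) //= big1 ?addr0 => [|b bl]; rewrite tensmxE mxE.
  by rewrite eqxx mulr1.
by rewrite eq_sym (negPf bl) mulr0 mul0r.
Qed.

Lemma ptraceK_ampll X (B : 'M[C]_(d * k)) :
  ptraceK (ampl k X *m B) = X *m ptraceK B.
Proof.
apply/matrixP => i j; rewrite !mxE.
under eq_bigr do rewrite mul_ampl_mx.
by rewrite exchange_big; apply: eq_bigr => a _; rewrite mxE mulr_sumr.
Qed.

Lemma ptraceK_adj (B : 'M[C]_(d * k)) : ptraceK (B^t*) = (ptraceK B)^t*.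
Proof.
by apply/matrixP => i j; rewrite !mxE rmorph_sum; apply: eq_bigr => m _;
   rewrite !mxE.
Qed.

Lemma ptraceK_amplr X (B : 'M[C]_(d * k)) :
  ptraceK (B *m ampl k X) = ptraceK B *m X.
Proof.
apply: adjmx_inj.
by rewrite -ptraceK_adj !adjmxM ampl_adj ptraceK_ampll ptraceK_adj.
Qed.

Lemma mxtrace_ptraceK (B : 'M[C]_(d * k)) : \tr (ptraceK B) = \tr B.
Proof. by rewrite /mxtrace big_mxtens; apply: eq_bigr => i _; rewrite mxE. Qed.

Lemma mxtrace_channel V rho X :
  \tr (rho *m channel V X) = \tr (predual V rho *m X).
Proof.
rewrite /predual -ptraceK_amplr mxtrace_ptraceK /channel -!mulmxA.
by rewrite [RHS]mxtrace_mulC !mulmxA.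
Qed.

(** For [X] unitary and [z] of modulus one this says that the group element (z, X) fixes [V]. The
    same relation with a tangent vector in place of [V] says that the vector is fixed. *)
Definition covariant V z X := ampl k X *m V = z *: (V *m X).

Lemma covariant_channel V z X :
  is_isometry V -> covariant V z X -> channel V X = z *: X.
Proof.
move=> V1 cX; rewrite /channel -mulmxA cX -scalemxAr mulmxA.
by rewrite [V^t* *m V]V1 mul1mx.
Qed.

Lemma covariantM V z w X Y :
  covariant V z X -> covariant V w Y -> covariant V (z * w) (X *m Y).
Proof.
move=> cX cY; rewrite /covariant amplM -mulmxA cY -scalemxAr.
by rewrite (mulmxA (ampl k X)) cX -scalemxAl scalerA mulmxA mulrC.
Qed.

Lemma covariantD V z X Y :
  covariant V z X -> covariant V z Y -> covariant V z (X + Y).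
Proof.
by move=> cX cY; rewrite /covariant linearD mulmxDl cX cY mulmxDr scalerDr.
Qed.

Lemma covariantZ V z c X : covariant V z X -> covariant V z (c *: X).
Proof.
move=> cX; rewrite /covariant linearZ /= -scalemxAl cX -scalemxAr !scalerA.
by rewrite mulrC.
Qed.

Lemma covariant1 V : covariant V 1 1%:M.
Proof. by rewrite /covariant ampl1 mul1mx mulmx1 scale1r. Qed.

Lemma covariantX V z X n : covariant V z X -> covariant V (z ^+ n) (X ^+ n).
Proof.
move=> cX; elim: n => [|n IH]; first by rewrite !expr0; exact: covariant1.
by rewrite !exprS; exact: covariantM.
Qed.

(** Since V^* V = 1, the two cross terms and the last square all equal T(X)^* T(X), so a single copy
    is left, with a minus sign. *)
Lemma schwarz_defect V X : is_isometry V ->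
  let D := ampl k X *m V - V *m channel V X in
  D^t* *m D = channel V (X^t* *m X) - (channel V X)^t* *m channel V X.
Proof.
move=> V1 /=; have : V^t* *m (ampl k X *m V) = channel V X.
  by rewrite /channel mulmxA.
move: (channel V X) => T TE.
rewrite adjmxB !adjmxM mulmxBl !mulmxBr.
have -> : V^t* *m (ampl k X)^t* *m (ampl k X *m V) = channel V (X^t* *m X).
  by rewrite /channel ampl_adj amplM !mulmxA.
have -> : V^t* *m (ampl k X)^t* *m (V *m T) = T^t* *m T.
  by rewrite mulmxA -TE !adjmxM trmxCK !mulmxA.
have -> : T^t* *m V^t* *m (ampl k X *m V) = T^t* *m T by rewrite -mulmxA TE.
rewrite -(mulmxA (T^t*)) (mulmxA (V^t*)) [V^t* *m V]V1 mul1mx.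
by rewrite subrr subr0.
Qed.

Lemma schwarz_eq V X : is_isometry V ->
  channel V (X^t* *m X) = (channel V X)^t* *m channel V X ->
  ampl k X *m V = V *m channel V X.
Proof.
move=> V1 e; apply/eqP; rewrite -subr_eq0; apply/eqP/adjmx_mul_eq0.
by rewrite schwarz_defect // e subrr.
Qed.

(** By cyclicity the trace is that of D rho D^*, whose diagonal entries are values of the form [rho]
    at the adjoints of the rows of D. These are nonnegative, so each of them vanishes. *)
Lemma posdef_trace_eq0 m rho (D : 'M[C]_(m, d)) : posdef rho ->
  \tr (rho *m (D^t* *m D)) = 0 -> D = 0.
Proof.
move=> rho_gt0; rewrite mulmxA mxtrace_mulC mulmxA.
have E i : (D *m rho *m D^t*) i i =
    ((row i D)^t*^t* *m rho *m (row i D)^t*) 0 0.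
  rewrite trmxCK -row_mul !mxE; apply: eq_bigr => j _.
  by rewrite !mxE.
have ge0 i : 0 <= (D *m rho *m D^t*) i i.
  rewrite E; have [->|nz] := eqVneq ((row i D)^t*) 0.
    by rewrite mulmx0 mxE.
  exact: ltW (rho_gt0 _ nz).
move=> /psumr_eq0P D0; apply/row_matrixP => i; rewrite row0.
apply: adjmx_inj; rewrite adjmx0; apply/eqP.
apply: contraT => nz; have := rho_gt0 _ nz.
by rewrite -E D0 ?ltxx // => j _; exact: ge0.
Qed.

(* Equality in the Schwarz inequality T(X^* X) >= T(X)^* T(X): the defect has
   zero expectation in the faithful invariant state. *)
Lemma peripheral_covariant V z X : Virr_set V -> `|z| = 1 ->
  channel V X = z *: X -> covariant V z X.
Proof.
case=> V1 [rho [_ rho_gt0 rho_inv _]] z1 TX.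
suff e : ampl k X *m V - V *m channel V X = 0.
  by rewrite /covariant; move/subr0_eq: e => ->; rewrite TX scalemxAr.
apply: (posdef_trace_eq0 rho_gt0); rewrite schwarz_defect // mulmxBr linearB /=.
rewrite mxtrace_channel rho_inv TX adjmxZ -scalemxAl -!scalemxAr scalerA.
by rewrite -normCKC z1 expr1n scale1r subrr.
Qed.

(** V X is a phase times (X (x) 1) V; the phases cancel and X leaves the partial trace on both
    sides. *)
Lemma covariant_predual V z X rho : `|z| = 1 -> covariant V z X ->
  predual V rho = rho -> predual V (X *m rho *m X^t*) = X *m rho *m X^t*.
Proof.
move=> z1 cX inv.
have XV : V *m X = z^* *: (ampl k X *m V).
  by rewrite cX scalerA -normCKC z1 expr1n scale1r.
rewrite /predual.
have -> : V *m (X *m rho *m X^t*) *m V^t* = (V *m X) *m rho *m (V *m X)^t*.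
  by rewrite adjmxM !mulmxA.
rewrite XV adjmxZ adjmxM -!scalemxAl -scalemxAr scalerA conjCK -normCKC z1.
rewrite expr1n scale1r ampl_adj.
have -> : ampl k X *m V *m rho *m (V^t* *m ampl k (X^t*)) =
          ampl k X *m (V *m rho *m V^t*) *m ampl k (X^t*) by rewrite !mulmxA.
by rewrite ptraceK_amplr ptraceK_ampll [ptraceK _]inv.
Qed.

Lemma psd_sandwich rho X : psd rho -> psd (X *m rho *m X^t*).
Proof.
by move=> rho_ge0 v; have := rho_ge0 (X^t* *m v); rewrite adjmxM trmxCK !mulmxA.
Qed.

Lemma psd_trace rho : psd rho -> 0 <= \tr rho.
Proof.
move=> rho_ge0; apply: sumr_ge0 => i _.
pose v : 'cV[C]_d := delta_mx i 0.
suff -> : rho i i = (v^t* *m rho *m v) 0 0 by exact: rho_ge0.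
by rewrite -colE trmx_delta map_delta_mx -rowE !mxE.
Qed.

Lemma psd_trace_sandwich_eq0 rho X : posdef rho ->
  \tr (X *m rho *m X^t*) = 0 -> X = 0.
Proof.
move=> rho_gt0 t0; apply: (posdef_trace_eq0 rho_gt0).
by rewrite mulmxA mxtrace_mulC mulmxA.
Qed.

(** X rho X^* is positive and invariant; normalised by its trace it is an invariant state, hence
    [rho] by uniqueness. If the trace vanishes, X = 0. *)
Lemma covariant_state V z X rho : is_state rho -> posdef rho ->
  predual V rho = rho ->
  (forall sigma, is_state sigma -> predual V sigma = sigma -> sigma = rho) ->
  `|z| = 1 -> covariant V z X ->
  exists c, X *m rho *m X^t* = c *: rho.
Proof.
move=> [rho_ge0 _] rho_gt0 inv uniq z1 cX.
have inv' := covariant_predual z1 cX inv.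
have [t0|t0] := eqVneq (\tr (X *m rho *m X^t*)) 0.
  by exists 0; rewrite (psd_trace_sandwich_eq0 rho_gt0 t0) !mul0mx scale0r.
set t := \tr _ in t0; exists t; apply: (canRL (scalerKV t0)).
apply: uniq; last first.
  by rewrite /predual -scalemxAr -scalemxAl linearZ /= [ptraceK _]inv'.
split; last by rewrite mxtraceZ mulVf.
move=> v; rewrite -scalemxAr -scalemxAl mxE mulr_ge0 ?invr_ge0 ?psd_trace //.
  exact: psd_sandwich.
exact: psd_sandwich.
Qed.

Lemma posdef_unit rho : posdef rho -> rho \in unitmx.
Proof.
move=> rho_gt0; rewrite -row_free_unit -kermx_eq0; apply/rowV0P => v.
move=> /sub_kermxP v0; apply: adjmx_inj; rewrite adjmx0; apply/eqP.
 apply: contraT => nz; have := rho_gt0 _ nz.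
by rewrite trmxCK v0 mul0mx mxE ltxx.
Qed.

(* Y rho Y^* is proportional to rho for Y = X, X + 1 and X + i; polarisation
   then makes X rho proportional to rho. *)
Lemma fixed_point_scalar V X : Virr_set V -> channel V X = X ->
  exists c, X = c%:M.
Proof.
move=> Virr TX; have [V1 [rho [rs rho_gt0 inv uniq]]] := Virr.
have cX : covariant V 1 X.
  by apply: peripheral_covariant; rewrite ?normr1 ?scale1r.
have scal Y : covariant V 1 Y -> exists c, Y *m rho *m Y^t* = c *: rho.
  by apply: (covariant_state rs rho_gt0 inv uniq); rewrite normr1.
have [c0 e0] := scal _ cX.
(* These are the cross terms of (X + a) rho (X + a)^*, whose other terms X rho X^* and rho are
   already multiples of rho. *)
have exp (a : C) : a * a^* = 1 ->
    exists c, a^* *: (X *m rho) + a *: (rho *m X^t*) = c *: rho.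
  move=> a1; have [c e] := scal _ (covariantD cX (covariantZ a (covariant1 V))).
  exists (c - c0 - 1).
  have : c *: rho =
    c0 *: rho + (a^* *: (X *m rho) + a *: (rho *m X^t*)) + rho.
    rewrite -e -e0 linearD map_mxD adjmxZ adjmx1 /=.
    rewrite !mulmxDl !mulmxDr -!scalemxAl -!scalemxAr !mul1mx !mulmx1 scalerA.
    by rewrite a1 scale1r !addrA.
  by rewrite !scalerBl scale1r => ->; rewrite addrAC addrK addrC addKr.
have [c1 e1] : exists c, X *m rho + rho *m X^t* = c *: rho.
  by have := exp 1; rewrite conjC1 mulr1 !scale1r; apply.
have [c2 e2] : exists c, X *m rho - rho *m X^t* = c *: rho.
  have [|c e] := exp 'i; first by rewrite conjCi mulrN -expr2 sqrCi opprK.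
  exists ('i * c); rewrite -scalerA -e conjCi scalerDr !scalerA mulrN -expr2.
  by rewrite sqrCi opprK scale1r scaleN1r.
have e3 : X *m rho = ((c1 + c2) / 2) *: rho.
  apply: (scalerI (_ : 2 != 0 :> C)); first by rewrite pnatr_eq0.
  rewrite scalerA mulrCA divff ?pnatr_eq0 // mulr1 [RHS]scalerDl -e1 -e2.
  by rewrite addrACA subrr addr0 -mulr2n scaler_nat.
exists ((c1 + c2) / 2); rewrite -[X](mulmxK (posdef_unit rho_gt0)) e3.
by rewrite -scalemxAl mulmxV ?posdef_unit // scalemx1.
Qed.

End Covariance.

(** * The peripheral group *)

(** Multiplication by z permutes [s], so the product of all elements equals itself times the power
    of z of exponent [size s]. *)
Lemma finite_mul_closed_unity (F : fieldType) (s : seq F) :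
  uniq s -> {in s, forall z, z != 0} -> {in s &, forall z w, z * w \in s} ->
  {in s, forall z, z ^+ size s = 1}.
Proof.
move=> us s0 sM z zs.
have inj : injective ( *%R z) by move=> x y /(mulfI (s0 _ zs)).
have sub : {subset [seq z * w | w <- s] <= s}.
  by move=> _ /mapP[w ws ->]; exact: sM.
have [_ eqs] := uniq_min_size (etrans (map_inj_uniq inj s) us) sub
                  (eq_leq (esym (size_map _ _))).
have zs_s : perm_eq [seq z * w | w <- s] s.
  by apply: uniq_perm => //; rewrite map_inj_uniq.
have : \prod_(w <- [seq z * w | w <- s]) w = \prod_(w <- s) w.
  exact: perm_big.
rewrite big_map big_split /= big_const_seq count_predT iter_mulr_1.
have P0 : \prod_(w <- s) w != 0.
  by rewrite prodf_seq_neq0; apply/allP => w ws; exact: s0.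
by move/(canRL (mulfK P0)) ->; rewrite divff.
Qed.

(** * Primitive roots of unity as exponentials *)

Section Gamma.
Variable R : realType.
Local Notation C := (Cplx R).

Definition cis (x : R) : C := (cos x +i* sin x)%C.

Lemma cisD x y : cis (x + y) = cis x * cis y.
Proof. by rewrite /cis cosD sinD [X in (_ +i* X)%C]addrC. Qed.

Lemma cisX x n : cis (x *+ n) = cis x ^+ n.
Proof.
elim: n => [|n IH]; last by rewrite mulrS exprS cisD IH.
by rewrite mulr0n expr0 /cis cos0 sin0.
Qed.

Lemma norm_cis x : `|cis x| = 1.
Proof. by rewrite /cis normc_def /= cos2Dsin2 sqrtr1. Qed.

(** By the half-angle formula cos x = 1 - 2 sin(x/2)^2, and sin is positive at x/2, which lies
    strictly between 0 and pi. *)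
Lemma cis_neq1 x : 0 < x < 2 * pi -> cis x != 1.
Proof.
case/andP=> x0 x2; apply/eqP => -[cx _].
have s_gt0 : 0 < sin (x / 2).
  by apply: sin_gt0_pi; rewrite divr_gt0 //= ltr_pdivrMr // mulrC.
have e : cos x = 1 - 2 * sin (x / 2) ^+ 2.
  rewrite {1}[x]splitr -mulr2n cos_mulr2n cos2sin2 mulrnBl mulr2n addrAC.
  by rewrite addrK mulrDl mul1r -mulr2n.
move: cx; rewrite e => /eqP; rewrite -subr_eq0 addrAC subrr add0r oppr_eq0.
by rewrite mulf_eq0 pnatr_eq0 sqrf_eq0 /= => /eqP s0; rewrite s0 ltxx in s_gt0.
Qed.

Lemma gamma_prim p : (0 < p)%N -> p.-primitive_root (gamma R p).
Proof.
move=> p0; have pR : 0 < p%:R :> R by rewrite ltr0n.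
rewrite /primitive_root_of_unity p0 /=; apply/forallP => -[j jp] /=.
rewrite unity_rootE -[gamma R p]/(cis (2 * pi / p%:R)) -cisX.
(* The exponent tested is j + 1, from 1 to p: at p the angle is a full turn, below p it lies
   strictly between 0 and a full turn. *)
move: jp; rewrite leq_eqVlt => /predU1P[->|jp].
  rewrite eqxx -(mulr_natr (2 * pi / p%:R)) (divfK (lt0r_neq0 pR)) mulr_natl.
  by rewrite /cis cos2pi sin2pi eqxx.
rewrite (ltn_eqF jp) (negPf (cis_neq1 _)) //.
have pi0 : 0 < 2 * pi :> R by rewrite mulr_gt0 // pi_gt0.
rewrite -(mulr_natr (2 * pi / p%:R)) mulrAC.
rewrite divr_gt0 ?mulr_gt0 ?ltr0n ?pi_gt0 //=.
by rewrite ltr_pdivrMr // ltr_pM2l // ltr_nat.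
Qed.

Lemma norm_gamma p : `|gamma R p| = 1.
Proof. exact: norm_cis. Qed.

Lemma norm1_conj (z : C) : `|z| = 1 -> z^* = z^-1.
Proof.
move=> z1; have z0 : z != 0 by rewrite -normr_eq0 z1 oner_eq0.
by apply: (mulfI z0); rewrite divff // -normCK z1 expr1n.
Qed.

End Gamma.

Section Peripheral.
Variables (R : realType) (d k : nat).
Local Notation C := (Cplx R).
Implicit Types (V A : 'M[C]_(d * k, d)) (X Y Z rho : 'M[C]_d) (z w c : C).

Lemma irr_dim_gt0 V : Virr_set V -> (0 < d)%N.
Proof.
case=> _ [rho [[_ tr1] _ _ _]]; case: d rho tr1 => // rho.
by rewrite /mxtrace big_ord0 => /esym/eqP; rewrite oner_eq0.
Qed.

Lemma unitarymx_adjl n (X : 'M[C]_n) : X \is unitarymx -> X^t* *m X = 1%:M.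
Proof.
by rewrite -trmxC_unitary => /unitarymxP; rewrite trmxCK.
Qed.

Lemma covariant_adj V z X : `|z| = 1 -> X \is unitarymx ->
  covariant V z X -> covariant V z^* (X^t*).
Proof.
move=> z1 uX cX; rewrite /covariant -[V in LHS]mulmx1 -(unitarymxP uX).
have -> : V *m (X *m X^t*) = z^* *: (ampl k X *m V *m X^t*).
  by rewrite cX -scalemxAl scalerA -normCKC z1 expr1n scale1r mulmxA.
rewrite -scalemxAr !mulmxA -amplM unitarymx_adjl // ampl1 mul1mx.
by [].
Qed.

(** Covariance makes X^* X a fixed point, hence a scalar a; it is positive because X is not zero,
    and dividing X by the square root of a gives a unitary. *)
Lemma peripheral_unitary V z X : Virr_set V -> `|z| = 1 -> X != 0 ->
  channel V X = z *: X -> exists2 c, c != 0 & c *: X \is unitarymx.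
Proof.
move=> Virr z1 X0 TX; have cX := peripheral_covariant Virr z1 TX.
have V1 := Virr.1.
have TXX : channel V (X^t* *m X) = X^t* *m X.
  have -> : channel V (X^t* *m X) = (ampl k X *m V)^t* *m (ampl k X *m V).
    by rewrite /channel amplM adjmxM ampl_adj !mulmxA.
  rewrite cX adjmxZ adjmxM -scalemxAl -scalemxAr scalerA -normCKC z1 expr1n.
  by rewrite scale1r mulmxA -(mulmxA _ _ V) [V^t* *m V]V1 mulmx1.
have [a XX] := fixed_point_scalar Virr TXX.
have d0 := irr_dim_gt0 Virr; pose i0 := Ordinal d0.
have a_ge0 : 0 <= a.
  have := adjmx_mulE X i0; rewrite XX !mxE eqxx mulr1n => ->.
  by apply: sumr_ge0 => i _; rewrite exprn_ge0.
have a0 : a != 0.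
  apply: contraNneq X0 => a0; apply/eqP/adjmx_mul_eq0.
  by rewrite XX a0 raddf0.
exists (sqrtC a)^-1; first by rewrite invr_eq0 sqrtC_eq0.
rewrite -trmxC_unitary; apply/unitarymxP.
rewrite trmxCK adjmxZ -scalemxAl -scalemxAr scalerA XX scale_scalar_mx.
have -> : ((sqrtC a)^-1)^* = (sqrtC a)^-1.
  by apply: CrealP; rewrite rpredV ger0_real // sqrtC_ge0.
by rewrite -invfM -expr2 sqrtCK mulVf.
Qed.

(** X^* Y is covariant with factor 1, hence a scalar c, and Y = X X^* Y = c X. *)
Lemma peripheral_simple V z X Y : Virr_set V -> `|z| = 1 ->
  X \is unitarymx -> covariant V z X -> covariant V z Y ->
  exists c, Y = c *: X.
Proof.
move=> Virr z1 uX cX cY.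
have := covariantM (covariant_adj z1 uX cX) cY.
rewrite -normCKC z1 expr1n => /(covariant_channel Virr.1); rewrite scale1r.
move=> /(fixed_point_scalar Virr)[c e]; exists c.
by rewrite -[Y]mul1mx -(unitarymxP uX) -mulmxA e mul_mx_scalar.
Qed.

Lemma is_eigenvalueP V z :
  is_eigenvalue V z <-> eigenvalue (lin_mx (channel V)) z.
Proof.
split=> [[X X0 e]|/eigenvalueP[v e v0]].
  by apply/eigenvalueP; exists (mxvec X);
     rewrite ?mul_vec_lin /= ?e ?linearZ // mxvec_eq0.
exists (vec_mx v); first by rewrite vec_mx_eq0.
by apply: (can_inj mxvecK); rewrite -mul_vec_lin linearZ /= !vec_mxK.
Qed.

(** The modulus-one roots of the characteristic polynomial form a finite set, closed under products
    because peripheral eigenvectors are multiples of unitaries. All n of them are n-th roots of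
    unity, so they exhaust these roots. *)
Lemma irr_has_period V : Virr_set V -> exists p, is_period V p.
Proof.
move=> Virr; have d0 := irr_dim_gt0 Virr.
have [rs cp] := closed_field_poly_normal (char_poly (lin_mx (channel V))).
move: cp; rewrite (monicP (char_poly_monic _)) scale1r => cp.
pose s := undup [seq z <- rs | `|z| == 1].
have sP z : z \in s <-> `|z| = 1 /\ is_eigenvalue V z.
  rewrite mem_undup mem_filter is_eigenvalueP eigenvalue_root_char cp.
  by rewrite root_prod_XsubC; split=> [/andP[/eqP]|[/eqP-> ->]].
have us : uniq s := undup_uniq _.
have s0 : {in s, forall z, z != 0}.
  by move=> z /sP[z1 _]; rewrite -normr_eq0 z1 oner_eq0.
have sM : {in s &, forall z w, z * w \in s}.
  move=> z w /sP[z1 [X X0 eX]] /sP[w1 [Y Y0 eY]]; apply/sP.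
  split; first by rewrite normrM z1 w1 mulr1.
  have [c c0 uX] := peripheral_unitary Virr z1 X0 eX.
  exists (c *: X *m Y).
    apply: contra_neq Y0 => XY0.
    by rewrite -[Y]mul1mx -(unitarymx_adjl uX) -mulmxA XY0 mulmx0.
  apply: (covariant_channel Virr.1); apply: covariantM.
    exact/covariantZ/peripheral_covariant.
  exact: peripheral_covariant.
have s1 : 1 \in s.
  apply/sP; rewrite normr1; split=> //; exists 1%:M.
    rewrite -mxrank_eq0 mxrank1 -lt0n //.
  exact: covariant_channel Virr.1 (covariant1 V).
have n0 : (0 < size s)%N by case: (s) s1.
have unity := finite_mul_closed_unity us s0 sM.
have root_s : (size s).-unity_root =i s.
  apply: mem_unity_roots => //; apply/allP => z zs.
  by rewrite unity_rootE unity.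
exists (size s); split=> // z; rewrite -sP -root_s -topredE /=.
have gp := gamma_prim R n0; split=> [|[j _ ->]].
  rewrite unity_rootE => /eqP/(prim_rootP gp)[j ->].
  by exists j.
by rewrite unity_rootE exprAC (prim_expr_order gp) expr1n.
Qed.

Lemma periodP V : Virr_set V -> is_period V (period V).
Proof. by move=> /irr_has_period[p Vp]; exact: (xgetI 0%N Vp). Qed.

End Peripheral.

(** * Dimension of spaces of intertwiners *)

Section LinearAlgebra.

(** A full-rank factorisation e = D B of an idempotent has B D = 1, of size the rank, and tr (D B) =
    tr (B D). *)
Lemma mxtrace_idempotent (F : fieldType) n (e : 'M[F]_n) :
  e *m e = e -> \tr e = (\rank e)%:R.
Proof.
move=> ee; have := mulmx_base e.
have := row_base_free e; have := col_base_full e.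
move: (row_base e) (col_base e) => B D Dfull Bfree DB.
have BD : B *m D = 1%:M.
  apply: (row_free_inj Bfree); apply: (row_full_inj Dfull).
  by rewrite mul1mx !mulmxA DB -mulmxA DB ee.
by rewrite -[in LHS]DB mxtrace_mulC BD mxtrace1.
Qed.

Lemma mxtrace_mxvec (F : pzRingType) m n (e : 'M[F]_(m * n))
    (f : 'M[F]_(m, n) -> 'M[F]_(m, n)) :
  (forall A, mxvec A *m e = mxvec (f A)) ->
  \tr e = \sum_i \sum_j f (delta_mx i j) i j.
Proof.
move=> ef; rewrite /mxtrace (reindex _ (curry_mxvec_bij m n)) /=.
rewrite pair_big; apply: eq_bigr => -[i j] _ /=.
transitivity (mxvec (f (delta_mx i j)) 0 (mxvec_index i j)); last exact: mxvecE.
by rewrite -ef mxvec_delta -rowE mxE.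
Qed.

Lemma mul_mx_delta_mx (F : pzRingType) m n p q (L : 'M[F]_(p, m))
    (P : 'M[F]_(n, q)) i j i' j' :
  (L *m delta_mx i j *m P) i' j' = L i' i * P j j'.
Proof.
have -> : delta_mx i j = delta_mx i ord0 *m delta_mx (ord0 : 'I_1) j
  :> 'M[F]_(m, n).
  by rewrite mul_delta_mx.
by rewrite mulmxA -mulmxA -colE -rowE mxE big_ord1 !mxE.
Qed.

End LinearAlgebra.

Section RealDimension.
Variables (R : realType) (d k : nat).
Local Notation C := (Cplx R).
Implicit Types (S T : set 'M[C]_(d * k, d)).

(** S is the row space of an idempotent acting on vectorised matrices. A complex basis of that
    space, together with its multiples by i, is a real basis. *)
Lemma real_dim_complex S (e : 'M[C]_(d * k * d)) :
  e *m e = e -> (forall A, S A <-> mxvec A *m e = mxvec A) ->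
  has_real_dim S (\rank e + \rank e).
Proof.
move=> ee SP; pose r : nat := \rank e; pose B := row_base e.
pose b (i : 'I_(r + r)) : 'M[C]_(d * k, d) :=
  match fintype.split i with
  | inl j => vec_mx (row j B)
  | inr j => 'i%C *: vec_mx (row j B)
  end.
have combE (x : 'I_(r + r) -> R) :
    mxvec (\sum_i (x i)%:C%C *: b i) =
    (\row_j (x (lshift r j) +i* x (rshift r j))%C : 'rV[C]_r) *m B.
  rewrite big_split_ord /= -big_split /= linear_sum mulmx_sum_row /=.
  apply: eq_bigr => j _; rewrite /b.
  rewrite (unsplitK (inl _ j)) (unsplitK (inr _ j)).
  rewrite scalerA -scalerDl linearZ /=.
  rewrite vec_mxK mxE; congr (_ *: _).
  by rewrite [RHS]complexE mulrC.
have Se A : S A <-> (mxvec A <= B)%MS.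
  rewrite SP /B eq_row_base; split=> [<-|/submxP[D ->]]; first exact: submxMl.
  by rewrite -mulmxA ee.
exists b; split=> [A|x].
  rewrite Se; split=> [/submxP[D eA]|[x ->]]; last by rewrite combE submxMl.
  exists (fun i => match fintype.split i with
    | inl j => complex.Re (D 0 j) | inr j => complex.Im (D 0 j) end).
  apply: (can_inj mxvecK); rewrite combE eA; congr (_ *m _).
  apply/rowP => j; rewrite mxE (unsplitK (inl _ j)) (unsplitK (inr _ j)).
  by case: (D 0 j).
move=> /(congr1 mxvec); rewrite combE linear0 => x0 i.
have /rowP y0 : (\row_j (x (lshift r j) +i* x (rshift r j))%C : 'rV[C]_r) = 0.
  by apply: (row_free_inj (row_base_free e)); rewrite mul0mx.
rewrite -(splitK i); case: (fintype.split i) => j /=.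
  by have := y0 j; rewrite !mxE => -[].
by have := y0 j; rewrite !mxE => -[].
Qed.

(** The coordinates of the basis of S in the one of T form a real matrix N with independent rows, so
    n is at most m; if n = m then N is invertible and expresses the basis of T in that of S. *)
Lemma real_dim_sub S T n m : has_real_dim S n -> has_real_dim T m ->
  S `<=` T -> (n <= m)%N /\ (n = m -> T `<=` S).
Proof.
move=> [b [bS bfree]] [c [cT _]] ST.
have /choice[M eM] : forall i, exists x : 'I_m -> R,
    b i = \sum_j (x j)%:C%C *: c j.
  move=> i; apply/cT/ST/bS; exists (fun j => (j == i)%:R).
  rewrite (bigD1 i) //= eqxx scale1r big1 ?addr0 // => j /negPf ->.
  by rewrite scale0r.
pose N : 'M[R]_(n, m) := \matrix_(i, j) M i j.
have combN (u : 'rV[R]_n) :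
    \sum_i (u 0 i)%:C%C *: b i = \sum_j ((u *m N) 0 j)%:C%C *: c j.
  under eq_bigr do rewrite eM scaler_sumr.
  rewrite exchange_big; apply: eq_bigr => j _.
  under eq_bigr do rewrite scalerA -rmorphM.
  rewrite -scaler_suml -rmorph_sum mxE.
  by congr (_%:C%C *: _); apply: eq_bigr => i _; rewrite mxE.
have Nfree : row_free N.
  rewrite -kermx_eq0; apply/rowV0P => u /sub_kermxP u0.
  apply/rowP => i; rewrite mxE; apply: (bfree (fun i => u 0 i)).
  by rewrite combN u0 big1 // => j _; rewrite mxE scale0r.
split; first by rewrite -(eqP Nfree) rank_leq_col.
move=> nm A /cT[y ->]; subst m; apply/bS.
pose u := (\row_j y j) *m invmx N; exists (fun i => u 0 i).
rewrite combN mulmxKV -?row_free_unit //.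
by apply: eq_bigr => j _; rewrite mxE.
Qed.

Lemma real_dim_inj S n m : has_real_dim S n -> has_real_dim S m -> n = m.
Proof.
move=> Sn Sm; apply/eqP; rewrite eqn_leq.
by rewrite (real_dim_sub Sn Sm _).1 ?(real_dim_sub Sm Sn _).1.
Qed.

End RealDimension.

(** * Families of projections shifted cyclically by an operator *)

Section CovariantFamily.
Variables (R : realType) (d k : nat).
Local Notation C := (Cplx R).
Implicit Types (V A : 'M[C]_(d * k, d)) (X W Z : 'M[C]_d) (z w c : C).
Implicit Types (P : nat -> 'M[C]_d).

(** The number [q] need not be the period and projections may vanish, so these conditions are stable
    under limits, unlike the periodic decomposition itself. *)
Definition resolution q P :=
  [/\ forall a, (a < q)%N -> (P a)^t* = P a,
      forall a b, (a < q)%N -> (b < q)%N -> P a *m P b = (a == b)%:R *: P a &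
      \sum_(a < q) P a = 1%:M].

Definition shifts q P A :=
  forall a, (a < q)%N -> A *m P a = ampl k (P (a.+1 %% q)%N) *m A.

(** At z = gamma^j this is the power Z^j of the unitary attached to the family. *)
Definition wsum q P z : 'M[C]_d := \sum_(a < q) z ^+ a *: P a.

Lemma sum_shift (M : nmodType) q (F : nat -> M) :
  \sum_(a < q) F (a.+1 %% q)%N = \sum_(a < q) F a.
Proof.
case: q => [|q]; first by rewrite !big_ord0.
rewrite big_ord_recr /= modnn [RHS]big_ord_recl addrC; congr (_ + _).
by apply: eq_bigr => i _; rewrite modn_small // ltnS.
Qed.

Lemma shift_eq q a b : (a < q)%N -> (b < q)%N ->
  (a.+1 %% q == b.+1 %% q)%N = (a == b).
Proof.
move=> aq bq; rewrite -(addn1 a) -(addn1 b) eqn_modDr.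
by rewrite !modn_small.
Qed.

Section Resolution.
Variables (q : nat) (P : nat -> 'M[C]_d).
Hypothesis PR : resolution q P.

Let Pmul := let: And3 _ h _ := PR in h.

Lemma wsum_mull z a : (a < q)%N -> P a *m wsum q P z = z ^+ a *: P a.
Proof.
move=> aq; rewrite mulmx_sumr (bigD1 (Ordinal aq)) //= big1 ?addr0.
  by rewrite -scalemxAr Pmul // eqxx scale1r.
move=> b; rewrite -val_eqE /= eq_sym => /negPf ba.
by rewrite -scalemxAr Pmul // ba scale0r scaler0.
Qed.

Lemma wsum_mulr z a : (a < q)%N -> wsum q P z *m P a = z ^+ a *: P a.
Proof.
move=> aq; rewrite mulmx_suml (bigD1 (Ordinal aq)) //= big1 ?addr0.
  by rewrite -scalemxAl Pmul // eqxx scale1r.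
move=> b; rewrite -val_eqE /= => /negPf ba.
by rewrite -scalemxAl Pmul // ba scale0r scaler0.
Qed.

Lemma wsumM z w : wsum q P z *m wsum q P w = wsum q P (z * w).
Proof.
rewrite {1}/wsum mulmx_suml; apply: eq_bigr => a _.
by rewrite -scalemxAl wsum_mull // scalerA exprMn.
Qed.

Lemma wsum1 : wsum q P 1 = 1%:M.
Proof.
case: PR => _ _ <-; apply: eq_bigr => a _; by rewrite expr1n scale1r.
Qed.

Lemma wsum_adj z : (wsum q P z)^t* = wsum q P z^*.
Proof.
case: PR => Ph _ _; rewrite adjmx_sum; apply: eq_bigr => a _.
by rewrite adjmxZ Ph // rmorphXn.
Qed.

Lemma wsum_unitary z : `|z| = 1 -> wsum q P z \is unitarymx.
Proof.
move=> z1; apply/unitarymxP; rewrite wsum_adj wsumM.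
by rewrite -normCK z1 expr1n wsum1.
Qed.

(** Moving A past a projection raises its index, hence its weight, by one step; z^q = 1 makes the
    step from q - 1 to 0 consistent. *)
Lemma shifts_covariant A z : z ^+ q = 1 -> shifts q P A ->
  covariant A z (wsum q P z).
Proof.
move=> zq sA; rewrite /covariant /wsum.
rewrite -[X in ampl k X](sum_shift q (fun a => z ^+ a *: P a)).
rewrite linear_sum mulmx_suml mulmx_sumr scaler_sumr; apply: eq_bigr => a _ /=.
rewrite linearZ /= -scalemxAl -sA // expr_mod // -scalemxAr scalerA.
by rewrite exprS.
Qed.

(** The block of A from P_a to P_b is multiplied by z^b on one side and by z^(a+1) on the other. As
    z is primitive, only the blocks with b = a + 1 modulo q survive. *)
Lemma covariant_shifts A z : q.-primitive_root z ->
  covariant A z (wsum q P z) -> shifts q P A.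
Proof.
move=> zq cA; have q0 := prim_order_gt0 zq; case: PR => _ _ P1.
have off a b : (a < q)%N -> (b < q)%N -> (b != a.+1 %% q)%N ->
    ampl k (P b) *m A *m P a = 0.
  move=> aq bq ba.
  have : ampl k (P b) *m (ampl k (wsum q P z) *m A) *m P a =
         ampl k (P b) *m (z *: (A *m wsum q P z)) *m P a by rewrite cA.
  rewrite mulmxA -amplM wsum_mull // linearZ /= -!scalemxAl -scalemxAr.
  rewrite mulmxA -scalemxAl -!mulmxA wsum_mulr // -!scalemxAr scalerA -exprS.
  move/eqP; rewrite -subr_eq0 -scalerBl scaler_eq0 subr_eq0.
  rewrite (eq_prim_root_expr zq) (modn_small bq) (negPf ba) /=.
  by move/eqP.
move=> a aq; have a'q : (a.+1 %% q < q)%N by rewrite ltn_mod.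
transitivity (ampl k (P (a.+1 %% q)%N) *m A *m P a).
  rewrite -{1}[A]mul1mx -ampl1 -P1 linear_sum !mulmx_suml /=.
  rewrite (bigD1 (Ordinal a'q)) //= big1 ?addr0 // => b ba.
  by apply: off.
rewrite -[RHS]mulmx1 -P1 mulmx_sumr (bigD1 (Ordinal aq)) //= big1 ?addr0 //.
move=> b; rewrite -val_eqE /= => ba; apply: off => //.
by rewrite shift_eq // eq_sym.
Qed.

Lemma resolution_rank a : (a < q)%N -> \tr (P a) = (\rank (P a))%:R.
Proof.
by move=> aq; apply: mxtrace_idempotent; rewrite Pmul // eqxx scale1r.
Qed.

End Resolution.

Lemma mxtrace_ampl X : \tr (ampl k X) = \tr X * k%:R.
Proof.
rewrite /mxtrace big_mxtens mulr_suml; apply: eq_bigr => i _.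
under eq_bigr do rewrite tensmxE mxE eqxx mulr1.
by rewrite sumr_const card_ord mulr_natr.
Qed.

Definition shift_intertwiners q P V : set 'M[C]_(d * k, d) :=
  [set A | Tid V A /\ shifts q P A].

(** Half of the singular dimension, for any list of ranks; it is an integer because the differences
    may be negative for arbitrary [r]. *)
Definition family_dim q (r : nat -> nat) : int :=
  \sum_(a < q) ((r (a.+1 %% q)%N)%:Z * k%:Z - (r a)%:Z) * (r a)%:Z.

Lemma shifts_range_comm q P V a : resolution q P -> shifts q P V ->
  (a < q)%N ->
  ampl k (P (a.+1 %% q)%N) *m (V *m V^t*) = V *m P a *m V^t* /\
  (V *m V^t*) *m ampl k (P (a.+1 %% q)%N) = V *m P a *m V^t*.
Proof.
move=> [Ph _ _] sV aq; rewrite mulmxA -sV //; split=> //.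
rewrite -!mulmxA; congr (_ *m _); apply: adjmx_inj.
rewrite !adjmxM trmxCK Ph // ampl_adj Ph ?sV //.
by rewrite ltn_mod (leq_ltn_trans _ aq).
Qed.

(* The space is the range of the projection
   A |-> (1 - V V^* ) sum_a (P_(a+1) (x) 1) A P_a, whose trace is a sum of
   products of traces. *)
Lemma shift_intertwiners_dim q P V :
  is_isometry V -> resolution q P -> shifts q P V ->
  exists m, m%:Z = family_dim q (fun a => \rank (P a)) /\
            has_real_dim (shift_intertwiners q P V) (m + m).
Proof.
move=> V1 PR sV; have [Ph Pm P1] := PR.
have mod_lt a : (a < q)%N -> (a.+1 %% q < q)%N.
  by move=> aq; rewrite ltn_mod (leq_ltn_trans _ aq).
(* Q projects onto the orthogonal complement of the range of V, where the tangent vectors take their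
   values. *)
have [Q QE] : exists Q : 'M[C]_(d * k), Q = 1%:M - V *m V^t* by eexists.
have QV : V *m V^t* *m Q = 0.
  rewrite QE mulmxBr mulmx1 mulmxA -(mulmxA V _ V) [V^t* *m V]V1 mulmx1.
  by rewrite subrr.
have comm a := @shifts_range_comm q P V a PR sV.
have Qcomm a : (a < q)%N ->
    ampl k (P (a.+1 %% q)%N) *m Q = Q *m ampl k (P (a.+1 %% q)%N).
  move=> aq; rewrite QE mulmxBr mulmxBl mulmx1 mul1mx.
  by rewrite (comm a aq).1 (comm a aq).2.
pose L a := Q *m ampl k (P (a.+1 %% q)%N).
pose f A := \sum_(a < q) L a *m A *m P a.
pose e := \sum_(a < q) lin_mulmx (L a) *m lin_mulmxr (P a).
have ef A : mxvec A *m e = mxvec (f A).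
  rewrite mulmx_sumr linear_sum; apply: eq_bigr => a _.
  by rewrite mulmxA !mul_vec_lin.
have f_mem A : shift_intertwiners q P V (f A).
  split=> [|b bq].
    rewrite /Tid /= mulmx_sumr big1 // => a _.
    by rewrite /L !mulmxA QV !mul0mx.
  transitivity (L b *m A *m P b).
    rewrite mulmx_suml (bigD1 (Ordinal bq)) //= big1 ?addr0.
      by rewrite -mulmxA Pm // eqxx scale1r.
    move=> a; rewrite -val_eqE /= => /negPf ab.
    by rewrite -mulmxA Pm // ab scale0r mulmx0.
  rewrite mulmx_sumr (bigD1 (Ordinal bq)) //= big1 ?addr0.
    rewrite /L !mulmxA (Qcomm b bq) -[in RHS](mulmxA Q) -amplM.
    by rewrite (Pm _ _ (mod_lt b bq) (mod_lt b bq)) eqxx scale1r.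
  move=> a; rewrite -val_eqE /= => ab.
  rewrite /L !mulmxA (Qcomm b bq) -(mulmxA Q) -amplM.
  rewrite (Pm _ _ (mod_lt b bq) (mod_lt a (ltn_ord a))) shift_eq //.
  by rewrite eq_sym (negPf ab) scale0r linear0 mulmx0 !mul0mx.
have f_id A : shift_intertwiners q P V A -> f A = A.
  move=> [TA sA]; rewrite -[RHS]mulmx1 -P1 mulmx_sumr; apply: eq_bigr => a _.
  rewrite /L -(mulmxA Q) -sA // -!mulmxA Pm // eqxx scale1r mulmxA.
  by rewrite QE mulmxBl mul1mx [V *m V^t* *m A]TA subr0.
have ee : e *m e = e.
  apply/row_matrixP => i; rewrite !rowE -[delta_mx _ _]vec_mxK mulmxA !ef.
  by rewrite f_id.
exists (\rank e); split; last first.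
  apply: real_dim_complex => // A; rewrite ef; split=> [/f_id -> //|].
  by move/(can_inj mxvecK) => <-.
(* In characteristic zero the rank of [e] is determined by its trace, which is summed over matrix
   units. *)
apply: (@intr_inj C); rewrite -pmulrn -mxtrace_idempotent //.
rewrite (mxtrace_mxvec ef) rmorph_sum /=.
transitivity (\sum_(a < q) \tr (L a) * \tr (P a)).
  rewrite /f; under eq_bigr do (under eq_bigr do rewrite summxE).
  under eq_bigr do rewrite exchange_big.
  rewrite exchange_big; apply: eq_bigr => a _.
  rewrite /mxtrace mulr_suml; apply: eq_bigr => i _.
  by rewrite mulr_sumr; apply: eq_bigr => j _; rewrite mul_mx_delta_mx.
apply: eq_bigr => a _; rewrite rmorphM rmorphB rmorphM /= -!pmulrn.
rewrite -!(resolution_rank PR) ?mod_lt //; congr (_ * _).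
(* Here tr L_a = k tr P_(a+1) - tr P_a, the last term being the trace of V P_a V^*. *)
rewrite /L QE mulmxBl mul1mx (comm _ _).2 // linearB /= mxtrace_ampl.
by rewrite mxtrace_mulC mulmxA [V^t* *m V]V1 mul1mx.
Qed.

End CovariantFamily.

(** * Periodic decompositions and stabilisers *)

Section Decomposition.
Variables (R : realType) (d k : nat).
Local Notation C := (Cplx R).
Implicit Types (V A : 'M[C]_(d * k, d)) (X W Z : 'M[C]_d) (z w c : C).
Implicit Types (P : nat -> 'M[C]_d).

Lemma decomposition_resolution V P :
  periodic_decomposition V P -> resolution (period V) P.
Proof.
move=> [Ph Pm P1 _ _]; split=> // [a /Ph[] //|a b aq bq].
have [->|ab] := eqVneq a b; last by rewrite Pm // scale0r.
by rewrite (Ph b bq).2 scale1r.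
Qed.

(** P_(a+1) and its image P_a under the channel are both projections, which is the equality case of
    the Schwarz inequality. *)
Lemma decomposition_shifts V P : is_isometry V ->
  periodic_decomposition V P -> shifts (period V) P V.
Proof.
move=> V1 [Ph Pm P1 TP _] a aq.
have a'q : (a.+1 %% period V < period V)%N.
  by rewrite ltn_mod (leq_ltn_trans _ aq).
apply: esym; rewrite schwarz_eq // TP //.
by rewrite (Ph _ a'q).1 (Ph _ a'q).2 TP // (Ph _ aq).1 (Ph _ aq).2.
Qed.

Lemma period_gt0 V : Virr_set V -> (0 < period V)%N.
Proof. by move=> /periodP[]. Qed.

Lemma unitarymx_neq0 X : (0 < d)%N -> X \is unitarymx -> X != 0.
Proof.
by move=> d0 uX; rewrite -mxrank_eq0 mxrank_unitary // -lt0n.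
Qed.

Lemma unitary_covariant_peripheral V z X : Virr_set V -> `|z| = 1 ->
  X \is unitarymx -> covariant V z X ->
  exists2 j, (j < period V)%N & z = gamma R (period V) ^+ j.
Proof.
move=> Virr z1 uX cX; apply/(periodP Virr).2; split=> //.
exists X; first exact: unitarymx_neq0 (irr_dim_gt0 Virr) uX.
exact: covariant_channel Virr.1 cX.
Qed.

Lemma mxexpZ c X n : (c *: X) ^+ n = c ^+ n *: X ^+ n.
Proof.
elim: n => [|n IH]; first by rewrite !expr0 scale1r.
by rewrite !exprS IH -[LHS]scalemxAl -scalemxAr scalerA.
Qed.

Lemma unitarymx_exp X n : X \is unitarymx -> X ^+ n \is unitarymx.
Proof.
move=> uX; elim: n => [|n IH]; last by rewrite exprS; exact: mul_unitarymx.
by rewrite expr0; apply/unitarymxP; rewrite adjmx1 mulmx1.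
Qed.

Lemma unitary_scale_norm c X : (0 < d)%N ->
  X \is unitarymx -> c *: X \is unitarymx -> `|c| = 1.
Proof.
move=> d0 /unitarymxP uX /unitarymxP.
rewrite adjmxZ -scalemxAl -scalemxAr uX scalerA -normCK.
move=> /matrixP/(_ (Ordinal d0) (Ordinal d0)); rewrite !mxE eqxx mulr1.
by move/eqP; rewrite sqrp_eq1 // => /eqP.
Qed.

Lemma sum_expr_root_unity (F : fieldType) n (x : F) :
  x ^+ n = 1 -> x != 1 -> \sum_(j < n) x ^+ j = 0.
Proof.
move=> xn x1; apply: (mulfI (_ : x - 1 != 0)); first by rewrite subr_eq0.
by rewrite -subrX1 xn subrr mulr0.
Qed.

Lemma gamma_neq0 p : gamma R p != 0.
Proof. by rewrite -normr_eq0 norm_gamma oner_eq0. Qed.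

(** If Z is a unitary eigenvector at gamma, then Z^p is a fixed point, hence a scalar of modulus
    one; dividing Z by a p-th root of this scalar normalises it. *)
Lemma peripheral_root V : Virr_set V ->
  exists Z, [/\ Z \is unitarymx, covariant V (gamma R (period V)) Z &
                Z ^+ period V = 1].
Proof.
move=> Virr; have d0 := irr_dim_gt0 Virr; have p0 := period_gt0 Virr.
have gp := gamma_prim R p0; have g1 := norm_gamma R (period V).
have [_ [X X0 TX]] : `|gamma R (period V)| = 1 /\
    is_eigenvalue V (gamma R (period V)).
  (* For period 1 the exponent 1 is out of range, hence the residue. *)
  apply/(periodP Virr).2; exists (1 %% period V)%N; first by rewrite ltn_mod.
  by rewrite (prim_expr_mod gp) expr1.
have [c c0 uX] := peripheral_unitary Virr g1 X0 TX.
have cX := covariantZ c (peripheral_covariant Virr g1 TX).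
move: (c *: X) uX cX => {c c0 X0 TX}Z uZ cZ.
have [c eZ] : exists c, Z ^+ period V = c%:M.
  apply: (fixed_point_scalar Virr); rewrite -[RHS]scale1r.
  rewrite -(prim_expr_order gp); apply: (covariant_channel Virr.1).
  exact: covariantX.
have c1 : `|c| = 1.
  have u1 : (1%:M : 'M[C]_d) \is unitarymx.
    by apply/unitarymxP; rewrite adjmx1 mulmx1.
  apply: (unitary_scale_norm d0 u1).
  by rewrite scalemx1 -eZ; exact: unitarymx_exp.
pose w := (period V).-root c.
have wc : w ^+ period V = c by rewrite rootCK.
have w1 : `|w| = 1.
  by apply/eqP; rewrite -(pexpr_eq1 p0) // -normrX wc c1.
exists (w^-1 *: Z); split; last 1 first.
- rewrite mxexpZ eZ exprVn wc scale_scalar_mx mulVf //.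
  by rewrite -normr_eq0 c1 oner_eq0.
- apply/unitarymxP; rewrite adjmxZ -scalemxAl -scalemxAr (unitarymxP uZ).
  by rewrite scalerA -normCK normfV w1 invr1 expr1n scale1r.
- exact: covariantZ.
Qed.

(* P_a is the spectral projection of Z at gamma^a, obtained by a discrete
   Fourier transform of the powers of Z. *)
Lemma irr_has_decomposition V : Virr_set V ->
  exists P, periodic_decomposition V P.
Proof.
move=> Virr; have p0 := period_gt0 Virr.
have gp := gamma_prim R p0; have [Z [uZ cZ Zp]] := peripheral_root Virr.
have V1 := Virr.1; move: (gamma_neq0 (period V)).
move: gp cZ; set g := gamma R _ => gp cZ g0.
have pC0 : (period V)%:R != 0 :> C by rewrite pnatr_eq0 -lt0n.
have gp1 := prim_expr_order gp.
have hp a : (g^-1 ^+ a) ^+ period V = 1.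
  by rewrite exprVn exprVn exprAC gp1 expr1n invr1.
pose P a : 'M[C]_d :=
  (period V)%:R^-1 *: \sum_(j < period V) (g^-1 ^+ a) ^+ j *: Z ^+ j.
(* Since Z^p = 1, multiplication by Z shifts the Fourier sum cyclically. *)
have ZP a : Z *m P a = g ^+ a *: P a.
  rewrite -scalemxAr scalerA mulrC -scalerA; congr (_ *: _).
  rewrite -[in RHS](sum_shift _ (fun j => (g^-1 ^+ a) ^+ j *: Z ^+ j)).
  rewrite mulmx_sumr scaler_sumr; apply: eq_bigr => j _.
  rewrite -scalemxAr !expr_mod // -[Z *m _]exprS scalerA; congr (_ *: _).
  rewrite exprS mulrA -exprMn.
  by rewrite mulfV // expr1n mul1r.
have ZXP a j : Z ^+ j *m P a = (g ^+ a) ^+ j *: P a.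
  elim: j => [|j IH]; first by rewrite !expr0 mul1mx scale1r.
  by rewrite exprSr -mulmxA ZP -scalemxAr IH scalerA exprS.
have Pmul a b : (a < period V)%N -> (b < period V)%N ->
    P a *m P b = (a == b)%:R *: P b.
  move=> ap bp; rewrite {1}/P -scalemxAl mulmx_suml.
  under eq_bigr do rewrite -scalemxAl ZXP scalerA -exprMn.
  rewrite -scaler_suml scalerA; congr (_ *: _).
  have [<-|ab] := eqVneq a b.
    rewrite -exprMn mulVf // expr1n; under eq_bigr do rewrite expr1n.
    by rewrite sumr_const card_ord mulVf.
  rewrite sum_expr_root_unity ?mulr0 //.
    by rewrite exprMn hp mul1r exprAC gp1 expr1n.
  rewrite exprVn; apply: contra_neq ab => e.
  have /eqP : g ^+ b = g ^+ a.
    by rewrite -[LHS](mulVKf (expf_neq0 a g0)) e mulr1.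
  by rewrite (eq_prim_root_expr gp) !modn_small // => /eqP.
(* Summing over a first, only the term j = 0 survives. *)
have P1 : \sum_(a < period V) P a = 1%:M.
  rewrite -scaler_sumr exchange_big /= (bigD1 (Ordinal p0)) //= addrC big1.
    under eq_bigr do rewrite !expr0 scale1r.
    rewrite add0r sumr_const card_ord -(scaler_nat _ (1 : 'M[C]_d)).
    rewrite scalerA mulVf //.
    by rewrite scale1r.
  move=> j j0; rewrite -scaler_suml.
  under eq_bigr do rewrite exprAC.
  rewrite sum_expr_root_unity ?scale0r //.
  rewrite exprVn invr_eq1 -(prim_order_dvd gp) gtnNdvd //.
  by rewrite lt0n -(inj_eq val_inj) in j0 *.
have Ph a : (a < period V)%N -> (P a)^t* = P a.
  (* Eigenspaces of a unitary are orthogonal. This turns P_a^* into P_a^* P_a, which is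
     self-adjoint. *)
  move=> ap; have off b : (b < period V)%N -> b != a -> (P a)^t* *m P b = 0.
    move=> bp ba.
    have : (Z *m P a)^t* *m (Z *m P b) = (P a)^t* *m P b.
      by rewrite adjmxM -mulmxA (mulmxA _ Z) unitarymx_adjl // mul1mx.
    rewrite !ZP adjmxZ -scalemxAl -scalemxAr scalerA => /eqP.
    rewrite -subr_eq0 -[X in _ - X]scale1r -scalerBl scaler_eq0 subr_eq0.
    rewrite norm1_conj; last by rewrite normrX norm_gamma expr1n.
    case/orP=> /eqP // e.
    have /eqP : g ^+ b = g ^+ a.
      by rewrite -[LHS](mulVKf (expf_neq0 a g0)) e mulr1.
    rewrite (eq_prim_root_expr gp) !modn_small // => /eqP e'.
    by rewrite e' eqxx in ba.
  have PP : (P a)^t* = (P a)^t* *m P a.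
    rewrite -[LHS]mulmx1 -P1 mulmx_sumr (bigD1 (Ordinal ap)) //= big1 ?addr0 //.
    by move=> b ba; apply: off.
  by rewrite -[RHS]trmxCK PP adjmxM trmxCK.
exists P; split=> //.
- move=> a ap; split; first exact: Ph.
  by rewrite (Pmul a a ap ap) eqxx scale1r.
- by move=> a b ap bp ab; rewrite (Pmul a b ap bp) (negPf ab) scale0r.
(* The channel multiplies Z^j by gamma^j, which lowers the index of the Fourier coefficient by
   one. *)
- move=> a ap; rewrite /P linearZ linear_sum; congr (_ *: _).
  apply: eq_bigr => j _.
  rewrite linearZ /= (covariant_channel V1 (covariantX j cZ)) scalerA.
  congr (_ *: _); rewrite expr_mod; last by rewrite exprVn gp1 invr1.
  by rewrite exprSr -exprMn mulfVK.
- suff -> : Zop V P = Z by split=> //; exact: covariant_channel.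
  rewrite -[RHS]mulmx1 -P1 mulmx_sumr; apply: eq_bigr => a _.
  by rewrite ZP.
Qed.

(** Reduces both the stabiliser and the fixed tangent vectors to a relation linear in [A] and in
    [W]. *)
Lemma gact_fixE c W A : `|c| = 1 -> W \is unitarymx ->
  gact c W A = A <-> covariant A c W.
Proof.
move=> c1 uW; have c0 : c != 0 by rewrite -normr_eq0 c1 oner_eq0.
rewrite /gact /covariant norm1_conj //; split=> [e|->].
  rewrite -[in RHS]e -scalemxAl scalerA divff // scale1r.
  by rewrite -mulmxA unitarymx_adjl // mulmx1.
rewrite -scalemxAl scalerA mulVf // scale1r -mulmxA (unitarymxP uW).
by rewrite mulmx1.
Qed.

(** Any family shifted by [V], for the period or not, yields an element (gamma, Z) of the
    stabiliser, and being fixed by it is the intertwining relation. *)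
Lemma fixed_sub_intertwiners V q P : (0 < q)%N ->
  resolution q P -> shifts q P V ->
  fixed_subspace V `<=` shift_intertwiners q P V.
Proof.
move=> q0 PR sV A [TA fixA]; split=> //.
have gq := gamma_prim R q0; have g1 := norm_gamma R q.
have uZ := wsum_unitary PR g1.
apply: (covariant_shifts PR gq); apply/gact_fixE => //; apply: fixA => //.
apply/gact_fixE => //; apply: shifts_covariant => //.
exact: prim_expr_order gq.
Qed.

(** The phase c is a peripheral eigenvalue, hence a power of gamma, and its simplicity determines W
    up to a scalar. *)
Lemma covariant_unique V P c W : Virr_set V -> periodic_decomposition V P ->
  `|c| = 1 -> W \is unitarymx -> covariant V c W ->
  exists j s, c = gamma R (period V) ^+ j /\
              W = s *: wsum (period V) P (gamma R (period V) ^+ j).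
Proof.
move=> Virr dP c1 uW cW; have p0 := period_gt0 Virr.
have PR := decomposition_resolution dP.
have sV := decomposition_shifts Virr.1 dP.
have gp := gamma_prim R p0.
have [j jp ec] := unitary_covariant_peripheral Virr c1 uW cW.
have uZ : wsum (period V) P c \is unitarymx by apply: wsum_unitary.
have cZ : covariant V c (wsum (period V) P c).
  apply: shifts_covariant => //.
  by rewrite ec exprAC (prim_expr_order gp) expr1n.
have [s eW] := peripheral_simple Virr c1 uZ cZ cW.
by exists j, s; rewrite -ec.
Qed.

Lemma fixed_subspaceE V P : Virr_set V -> periodic_decomposition V P ->
  fixed_subspace V = intertwiners V P.
Proof.
move=> Virr dP; have p0 := period_gt0 Virr.
have PR := decomposition_resolution dP.
have sV := decomposition_shifts Virr.1 dP.
have gp := gamma_prim R p0.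
rewrite eqEsubset; split; first exact: fixed_sub_intertwiners.
move=> A [TA sA]; split=> // c W c1 uW /(gact_fixE _ c1 uW) cW.
apply/gact_fixE => //.
have [j [s [-> ->]]] := covariant_unique Virr dP c1 uW cW.
apply/covariantZ/shifts_covariant => //.
by rewrite exprAC (prim_expr_order gp) expr1n.
Qed.

Lemma phase_classZ c W : `|c| = 1 -> phase_class (c *: W) = phase_class W.
Proof.
move=> c1; have c0 : c != 0 by rewrite -normr_eq0 c1 oner_eq0.
rewrite eqEsubset; split=> _ [z /= z1 <-].
  by exists (z * c); rewrite /= ?normrM ?z1 ?c1 ?mulr1 // scalerA.
exists (z / c); rewrite /= ?normrM ?normfV ?z1 ?c1 ?invr1 ?mulr1 //.
by rewrite scalerA divfK.
Qed.

Lemma phase_classM W W' : phase_class (W *m W') =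
  [set X *m Y | X in phase_class W & Y in phase_class W'].
Proof.
rewrite eqEsubset.
split=> [_ [z /= z1 <-]|_ [_ [z /= z1 <-]] [_ [w /= w1 <-]] <-].
  exists (z *: W); first by exists z.
  by exists W'; [exists 1; rewrite /= ?normr1 // scale1r | rewrite scalemxAl].
exists (w * z); first by rewrite /= normrM w1 z1 mulr1.
by rewrite -scalemxAl -scalemxAr scalerA mulrC.
Qed.

Lemma stabiliser_decomposition V P : Virr_set V ->
  periodic_decomposition V P -> stabiliser_iso_Zmod V (period V).
Proof.
move=> Virr dP; have p0 := period_gt0 Virr.
have PR := decomposition_resolution dP.
have sV := decomposition_shifts Virr.1 dP.
have gp := gamma_prim R p0; have g0 := gamma_neq0 (period V).
have gz1 a : `|gamma R (period V) ^ a| = 1.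
  case: a => n; rewrite ?NegzE -?exprnN ?normfV normrX norm_gamma expr1n //.
  by rewrite invr1.
have gzp a : (gamma R (period V) ^ a) ^+ period V = 1.
  by rewrite exprnP exprzAC -exprnP (prim_expr_order gp) exp1rz.
(* The integer a goes to the a-th power of the generator (gamma, Z). *)
exists (fun a => (gamma R (period V) ^ a,
                  phase_class (wsum (period V) P (gamma R (period V) ^ a)))).
split=> [a b|a b|].
- rewrite (expfzDr _ _ g0) -(wsumM PR) phase_classM.
  by rewrite /gmul.
- have eqg : gamma R (period V) ^ a = gamma R (period V) ^ b <->
             (a = b %[mod (period V)%:Z])%Z.
    have -> : gamma R (period V) ^ a = gamma R (period V) ^ b <->
              gamma R (period V) ^ (a - b) = 1.
      rewrite expfzDr // -invr_expz; split=> [->|].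
        by rewrite divff // expfz_neq0.
      by move/(canRL (mulfVK (expfz_neq0 _ g0))); rewrite mul1r.
    have -> : gamma R (period V) ^ (a - b) = 1 <-> (period V %| `|a - b|)%N.
      rewrite (prim_order_dvd gp); case: (a - b) => n; first by split=> /eqP.
      rewrite NegzE -exprnN abszN absz_nat.
      by split=> /eqP => [|->]; rewrite ?invr_eq1 ?invr1.
    by split=> [h|/eqP]; [apply/eqP|]; rewrite eqz_mod_dvd dvdzE.
  by rewrite -eqg; split=> [[]|->].
- rewrite eqEsubset.
  split=> [_ [a _ <-]|_ [c [W [c1 uW /(gact_fixE _ c1 uW) cW ->]]]].
    exists (gamma R (period V) ^ a).
    exists (wsum (period V) P (gamma R (period V) ^ a)).
    split=> //; first exact: wsum_unitary.
    by apply/gact_fixE; [|exact: wsum_unitary|exact: shifts_covariant].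
  have [j [s [ec eW]]] := covariant_unique Virr dP c1 uW cW.
  exists j%:Z => //; rewrite -exprnP -ec eW phase_classZ -?ec //.
  apply: (@unitary_scale_norm _ (wsum (period V) P c)).
  + exact: irr_dim_gt0 Virr.
  + exact: wsum_unitary.
  + by rewrite ec -eW.
Qed.

Lemma channel_gact c W V X : `|c| = 1 -> W \is unitarymx ->
  channel (gact c W V) (W *m X *m W^t*) = W *m channel V X *m W^t*.
Proof.
move=> c1 uW; rewrite /channel /gact adjmxZ conjCK -!scalemxAl -scalemxAr.
rewrite scalerA -normCK c1 expr1n scale1r !adjmxM trmxCK ampl_adj.
have WW : ampl k (W^t*) *m ampl k W = 1%:M.
  by rewrite -amplM unitarymx_adjl // ampl1.
rewrite !amplM !mulmxA -(mulmxA (W *m V^t*) _ (ampl k W)) WW mulmx1.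
by rewrite -(mulmxA _ (ampl k (W^t*)) (ampl k W)) WW mulmx1.
Qed.

Lemma orbit_eigenvalue V V' z : orbit_rel V V' ->
  is_eigenvalue V z -> is_eigenvalue V' z.
Proof.
move=> [c [W [c1 uW ->]]] [X X0 TX]; exists (W *m X *m W^t*).
  apply: contra_neq X0 => e.
  rewrite -[X]mul1mx -[X]mulmx1 -(unitarymx_adjl uW) !mulmxA.
  by rewrite -(mulmxA _ W) -(mulmxA _ _ (W^t*)) e mulmx0 mul0mx.
by rewrite channel_gact // TX -scalemxAr -scalemxAl.
Qed.

Lemma orbit_period V V' : orbit_rel V V' -> period V = period V'.
Proof.
move=> VV'; congr (xget _ _); apply/predeqP => p.
have E z : is_eigenvalue V z <-> is_eigenvalue V' z.
  split; first exact: orbit_eigenvalue VV'.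
  exact: orbit_eigenvalue (orbit_rel_sym VV').
by split=> -[p0 h]; split=> // z; rewrite -h E.
Qed.

Lemma gact_cancel c W : `|c| = 1 -> W \is unitarymx ->
  cancel (@gact R d k c W) (gact c^* (W^t*)).
Proof.
move=> c1 uW A.
by rewrite gactM -normCKC c1 expr1n unitarymx_adjl // gact1.
Qed.

Lemma fixed_subspace_gact c W V A : `|c| = 1 -> W \is unitarymx ->
  fixed_subspace V A -> fixed_subspace (gact c W V) (gact c W A).
Proof.
move=> c1 uW [TA fixA]; split.
  rewrite /Tid /= /gact adjmxZ conjCK -!scalemxAr -!scalemxAl !scalerA.
  rewrite !adjmxM trmxCK ampl_adj !mulmxA.
  rewrite -(mulmxA _ (W^t*) W) unitarymx_adjl // mulmx1.
  rewrite -(mulmxA _ (ampl k (W^t*)) (ampl k W)) -amplM unitarymx_adjl //.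
  rewrite ampl1 mulmx1 -(mulmxA (ampl k W)) -(mulmxA (ampl k W)).
  by rewrite [V *m V^t* *m A]TA mulmx0 mul0mx scaler0.
move=> c' W' c'1 uW' e.
have cK : c * c^* = 1 by rewrite -normCK c1 expr1n.
(* Conjugation carries the stabiliser of the transported point back to that of V. *)
have : gact (c^* * c' * c) (W^t* *m W' *m W) A = A.
  apply: fixA; first by rewrite !normrM norm_conjC c1 c'1 !mulr1.
    apply: (mul_unitarymx _ uW); apply: (mul_unitarymx _ uW').
    by rewrite trmxC_unitary.
  by rewrite -!gactM e gact_cancel.
move/(congr1 (gact c W)); rewrite gactM !mulrA cK mul1r.
rewrite !mulmxA (unitarymxP uW) mul1mx => e'.
by rewrite gactM.
Qed.

Lemma orbit_fixed_iso V V' : orbit_rel V V' ->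
  real_linear_iso (fixed_subspace V) (fixed_subspace V').
Proof.
move=> [c [W [c1 uW ->]]]; exists (gact c W); split.
- split=> [A|A B _ _|B fB].
  + exact: fixed_subspace_gact.
  + exact: (can_inj (gact_cancel c1 uW)).
  + have c1' : `|c^*| = 1 by rewrite norm_conjC.
    have uW' : W^t* \is unitarymx by rewrite trmxC_unitary.
    exists (gact c^* (W^t*) B).
      by have := fixed_subspace_gact c1' uW' fB; rewrite gact_cancel.
    by have := gact_cancel c1' uW' B; rewrite conjCK trmxCK.
- by move=> A B _ _; rewrite /gact mulmxDr mulmxDl scalerDr.
- by move=> x A _; rewrite /gact -scalemxAr -scalemxAl !scalerA mulrC.
Qed.

Lemma cls_eq (v w : Virr R d k) :
  cls v = cls w <-> orbit_rel (mx_of v) (mx_of w).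
Proof.
rewrite /cls; split=> [/eqmodP/asboolP //|vw]; exact/eqmodP/asboolP.
Qed.

Lemma isometry_dim V : is_isometry V -> (0 < d)%N -> (0 < k)%N.
Proof.
move=> V1 d0; rewrite lt0n; apply: contraTneq d0 => k0.
have := mxrankM_maxl (V^t*) V; rewrite [V^t* *m V]V1 mxrank1.
move=> /leq_trans/(_ (rank_leq_col _)); rewrite k0 muln0 leqn0 => /eqP ->.
by [].
Qed.

(** This is the dimension formula for q = 1 and the single projection 1, where the intertwining
    relation is empty. *)
Lemma Tid_dim V : Virr_set V -> has_real_dim (Tid V) (2 * d ^ 2 * (k - 1)).
Proof.
move=> Virr; have V1 := Virr.1; have d0 := irr_dim_gt0 Virr.
have k0 := isometry_dim V1 d0.
pose P := (fun _ => 1%:M) : nat -> 'M[C]_d.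
have PR : resolution 1 P.
  split=> [a _|[|a] [|b] // _ _|]; first by rewrite adjmx1.
    by rewrite mulmx1 eqxx scale1r.
  by rewrite big_ord1.
have sP A : shifts 1 P A by move=> a _; rewrite ampl1 mulmx1 mul1mx.
have [m [em dimm]] := shift_intertwiners_dim V1 PR (sP V).
have -> : Tid V = shift_intertwiners 1 P V.
  by rewrite eqEsubset; split=> A; [split | case].
suff -> : (2 * d ^ 2 * (k - 1) = m + m)%N by [].
move: em; rewrite /family_dim big_ord1 !mxrank1 => em.
have -> : m = ((d * k - d) * d)%N.
  by apply/eqP; rewrite -eqz_nat em PoszM -subzn // leq_pmulr.
rewrite (_ : d * k - d = d * (k - 1))%N; last by rewrite mulnBr muln1.
by rewrite addnn -mul2n -mulnA -mulnn mulnAC.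
Qed.

End Decomposition.

(** * Closedness in the space of isometries *)

Section Topology.
Variables (R : realType).
Local Notation C := (Cplx R).

Definition entrywise_continuous (T : topologicalType) m n
    (f : T -> 'M[C]_(m, n)) :=
  forall i j, continuous (fun t => f t i j).

Section EntrywiseContinuity.
Variable T : topologicalType.

Lemma entrywise_continuousW m n (f : T -> 'M[C]_(m, n)) :
  entrywise_continuous f -> continuous f.
Proof.
move=> cf t A [P nP sPA].
have : \forall s \near t, forall i j, P i j (f s i j).
  apply: filter_forall => i; apply: filter_forall => j.
  exact: cf (nP i j).
by apply: filterS => s; exact: sPA.
Qed.

Lemma closed_entrywise_eq m n (f g : T -> 'M[C]_(m, n)) :
  entrywise_continuous f -> entrywise_continuous g ->
  closed [set t | f t = g t].
Proof.
move=> cf cg.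
have -> : [set t | f t = g t] =
    \bigcap_(ij in [set: 'I_m * 'I_n])
      (fun t => f t ij.1 ij.2 - g t ij.1 ij.2) @^-1` [set 0].
  apply/predeqP => t; split=> /= [e [i j] _ /=|e]; first by rewrite e subrr.
  by apply/matrixP => i j; apply/subr0_eq; exact: e (i, j) I.
apply: closed_bigI => -[i j] _; apply: preimage_closed.
  by move=> t _; apply: continuousB; [exact: cf | exact: cg].
exact/accessible_closed_set1/hausdorff_accessible/norm_hausdorff.
Qed.

Lemma entrywise_cst m n (M : 'M[C]_(m, n)) :
  entrywise_continuous (fun _ : T => M).
Proof. by move=> i j; exact: cst_continuous. Qed.

Lemma continuous_sumC (I : Type) (r : seq I) (F : I -> T -> C) :
  (forall i, continuous (F i)) -> continuous (fun t => \sum_(i <- r) F i t).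
Proof.
move=> cF; elim: r => [|a r IH].
  by under eq_fun do rewrite big_nil; exact: cst_continuous.
under eq_fun do rewrite big_cons.
by move=> t; apply: continuousD; [exact: cF | exact: IH].
Qed.

Lemma entrywise_mul m n p (f : T -> 'M[C]_(m, n)) (g : T -> 'M[C]_(n, p)) :
  entrywise_continuous f -> entrywise_continuous g ->
  entrywise_continuous (fun t => f t *m g t).
Proof.
move=> cf cg i j; under eq_fun do rewrite mxE.
apply: continuous_sumC => l t.
by apply: continuousM; [exact: cf | exact: cg].
Qed.

Lemma entrywise_sum m n (I : Type) (r : seq I) (F : I -> T -> 'M[C]_(m, n)) :
  (forall i, entrywise_continuous (F i)) ->
  entrywise_continuous (fun t => \sum_(i <- r) F i t).
Proof.
move=> cF i j; under eq_fun do rewrite summxE.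
by apply: continuous_sumC => l; exact: cF.
Qed.

Lemma conj_continuous : continuous (Num.conj : C -> C).
Proof.
move=> z A /(nbhs_ballP (z^* : C))[e e0 eA]; apply/(nbhs_ballP z).
exists e => // w zw; apply: eA.
by move: zw; rewrite /ball /= -rmorphB norm_conjC.
Qed.

Lemma entrywise_adj m n (f : T -> 'M[C]_(m, n)) :
  entrywise_continuous f -> entrywise_continuous (fun t => (f t)^t*).
Proof.
move=> cf i j; under eq_fun do rewrite !mxE.
by move=> t; apply: continuous_comp; [exact: cf | exact: conj_continuous].
Qed.

Lemma entrywise_ampl d k (f : T -> 'M[C]_d) :
  entrywise_continuous f -> entrywise_continuous (fun t => ampl k (f t)).
Proof.
move=> cf i j; under eq_fun do rewrite mxE.
by move=> t; apply: continuousM; [exact: cf | exact: cst_continuous].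
Qed.

End EntrywiseContinuity.

Lemma real_complex_continuous : continuous (fun x : R => x%:C%C : C).
Proof.
move=> x A /(nbhs_ballP (x%:C%C : C))[e e0 eA].
have er : (complex.Re e)%:C%C = e by apply: RRe_real; exact: gtr0_real.
have e0' : 0 < complex.Re e by rewrite -ltcR er.
apply/(nbhs_ballP x); exists (complex.Re e) => // y xy; apply: eA.
rewrite /ball /= -rmorphB normc_def /= expr0n /= addr0 sqrtr_sqr -er ltcR.
exact: xy.
Qed.

(** A set whose compactness comes from real segments and which contains the closed unit disc, where
    the entries of isometries and projections lie. *)
Definition unit_square : set C :=
  [set z | `|complex.Re z| <= 1 /\ `|complex.Im z| <= 1].

Lemma unit_square_compact : compact unit_square.
Proof.
pose f (xy : R * R) : C := xy.1%:C%C + 'i%C * xy.2%:C%C.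
have -> : unit_square = f @` (`[-1, 1] `*` `[-1, 1])%classic.
  apply/predeqP => -[x y]; split=> /= [[x1 y1]|].
    exists (x, y); first by rewrite /= !in_itv /= -!ler_norml.
    by rewrite [RHS]complexE.
  move=> [[x' y'] /= []]; rewrite !in_itv /= -!ler_norml => x1 y1 <-.
  have -> : f (x', y') = (x' +i* y')%C by rewrite [RHS]complexE.
  by split.
apply: continuous_compact; last first.
  by apply: compact_setX; exact: segment_compact.
apply: continuous_subspaceT.
have c1 : continuous (fun p : R * R => p.1%:C%C : C).
  move=> p; apply: (@continuous_comp _ _ _ fst (fun x : R => x%:C%C : C)).
    exact: cvg_fst.
  exact: real_complex_continuous.
have c2 : continuous (fun p : R * R => p.2%:C%C : C).
  move=> p; apply: (@continuous_comp _ _ _ snd (fun x : R => x%:C%C : C)).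
    exact: cvg_snd.
  exact: real_complex_continuous.
move=> p; apply: (continuousD (c1 p)).
exact: (continuousM (@cst_continuous _ _ ('i%C : C) p) (c2 p)).
Qed.

Lemma unit_disc_square (z : C) : `|z| <= 1 -> unit_square z.
Proof.
move=> z1; split; rewrite -lecR (le_trans _ z1) //.
  exact: normc_ge_Re.
have := normc_ge_Re (z * 'i%C); rewrite normrM.
rewrite [complex.Re _](_ : _ = - complex.Im z) ?normrN; last exact: ReiNIm.
by rewrite [X in _ * X]normc_def /= expr0n add0r expr1n sqrtr1 mulr1.
Qed.

Lemma isometry_entry m n (A : 'M[C]_(m, n)) i j : A^t* *m A = 1%:M ->
  `|A i j| <= 1.
Proof.
move=> A1; have := adjmx_mulE A j; rewrite A1 mxE eqxx => e.
rewrite -(@expr_le1 _ 2) // [leRHS]e (bigD1 i) //= lerDl.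
by apply: sumr_ge0 => l _; rewrite exprn_ge0.
Qed.

End Topology.

(** * Closedness of the isometries admitting a shifted family *)

Section FamilySet.
Variables (R : realType) (d k : nat).
Local Notation C := (Cplx R).

(** Irreducibility is left out, since it need not survive limits. *)
Definition family_set q (r : nat -> nat) : set 'M[C]_(d * k, d) :=
  [set V | is_isometry V /\ exists P : nat -> 'M[C]_d,
    [/\ resolution q P, shifts q P V &
        forall a, (a < q)%N -> \rank (P a) = r a]].

(** The j-th diagonal entry of 1 is the sum of those of P_b = P_b^* P_b, that is, of the squared
    moduli of all entries in column j. *)
Lemma resolution_entry q (P : nat -> 'M[C]_d) a i j : resolution q P ->
  (a < q)%N -> `|P a i j| <= 1.
Proof.
move=> [Ph Pm P1] aq.
have : (1%:M : 'M[C]_d) j j = \sum_(b < q) \sum_l `|P b l j| ^+ 2.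
  rewrite -P1 summxE; apply: eq_bigr => b _; rewrite -adjmx_mulE Ph // Pm //.
  by rewrite eqxx scale1r.
rewrite mxE eqxx => e; rewrite -(@expr_le1 _ 2) // [leRHS]e.
rewrite (bigD1 (Ordinal aq)) //= (bigD1 i) //= -addrA lerDl addr_ge0 //.
  by apply: sumr_ge0 => l _; rewrite exprn_ge0.
by apply: sumr_ge0 => b _; apply: sumr_ge0 => l _; rewrite exprn_ge0.
Qed.

(* The pairs (V, P) form a compact set, of which this is a projection. *)
Lemma family_set_closed q (r : nat -> nat) : closed (family_set q r).
Proof.
pose J : finType := ('I_(d * k) * 'I_d + 'I_q * 'I_d * 'I_d)%type.
pose U := 'rV[C]_#|J|.
pose V (u : U) : 'M[C]_(d * k, d) :=
  \matrix_(i, j) u ord0 (enum_rank (inl (i, j) : J)).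
(* The default value 0 is taken only for a >= q. *)
pose P (u : U) a : 'M[C]_d :=
  \matrix_(i, j)
    if insub a is Some b then u ord0 (enum_rank (inr (b, i, j) : J)) else 0.
have PE u (a : 'I_q) i j :
    P u a i j = u ord0 (enum_rank (inr (a, i, j) : J)).
  by rewrite mxE valK.
have cV : entrywise_continuous V.
  by move=> i j; under eq_fun do rewrite mxE; exact: coord_continuous.
have cP a : entrywise_continuous (fun u => P u a).
  move=> i j; under eq_fun do rewrite mxE.
  by case: insub => [b|]; [exact: coord_continuous | exact: cst_continuous].
(* Scalars are written as matrix factors and ranks as traces, so that every condition is an equation
   between continuous matrix functions. *)
pose K : set U :=
  [set u | (V u)^t* *m V u = 1%:M] `&`
  \bigcap_(a in `I_q) [set u | (P u a)^t* = P u a] `&`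
  \bigcap_(a in `I_q) \bigcap_(b in `I_q)
     [set u | P u a *m P u b = (a == b)%:R%:M *m P u a] `&`
  [set u | \sum_(a < q) P u a = 1%:M] `&`
  \bigcap_(a in `I_q)
     [set u | V u *m P u a = ampl k (P u (a.+1 %% q)%N) *m V u] `&`
  \bigcap_(a in `I_q) [set u | (\tr (P u a))%:M = (r a)%:R%:M :> 'M[C]_1].
have KP u : K u <-> [/\ is_isometry (V u), resolution q (P u),
    shifts q (P u) (V u) & forall a, (a < q)%N -> \tr (P u a) = (r a)%:R].
  split=> [[[[[[V1 Ph] Pm] P1] sV] tr]|[V1 [Ph Pm P1] sV tr]].
    split=> //; first split=> //.
      by move=> a b aq bq; rewrite (Pm a aq b bq) mul_scalar_mx.
    move=> a aq; have /matrixP/(_ 0 0) := tr a aq.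
    by rewrite !mxE eqxx.
  split; last by move=> a aq /=; rewrite tr.
  split=> //; split=> //; split=> // a aq b bq /=.
  by rewrite Pm // mul_scalar_mx.
have Kclosed : closed K.
  have eq_adj := entrywise_adj; have eq_mul := entrywise_mul.
  have eq_cst := entrywise_cst; have eq_ampl := entrywise_ampl.
  do !apply: closedI.
  - by apply: closed_entrywise_eq => //; apply: eq_mul => //; exact: eq_adj.
  - apply: closed_bigI => a _; apply: closed_entrywise_eq => //.
    exact: eq_adj.
  - apply: closed_bigI => a _; apply: closed_bigI => b _.
    by apply: closed_entrywise_eq; exact: eq_mul.
  - by apply: closed_entrywise_eq => //; exact: entrywise_sum.
  - apply: closed_bigI => a _; apply: closed_entrywise_eq; first exact: eq_mul.
    by apply: eq_mul => //; exact: eq_ampl.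
  - apply: closed_bigI => a _; apply: closed_entrywise_eq => //.
    move=> i j; under eq_fun do rewrite mxE.
    case: (i == j); last first.
      by under eq_fun do rewrite mulr0n; exact: cst_continuous.
    under eq_fun do rewrite mulr1n.
    by apply: continuous_sumC => l; exact: cP.
have Kcompact : compact K.
  apply: (subclosed_compact Kclosed
           (rV_compact (fun _ => @unit_square_compact R))) => u /KP[V1 PR _ _] x.
  rewrite -(enum_valK x); case: (enum_val x) => [[i j]|[[a i] j]].
    have -> : u ord0 (enum_rank (inl (i, j) : J)) = V u i j by rewrite mxE.
    exact/unit_disc_square/isometry_entry.
  rewrite -PE; exact: unit_disc_square (resolution_entry i j PR (ltn_ord a)).
have -> : family_set q r = V @` K.
  apply/predeqP => V0; split=> [[V1 [P0 [PR sV rk]]]|[u /KP[V1 PR sV tr] <-]].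
    pose u : U := \row_x
      match enum_val x : 'I_(d * k) * 'I_d + 'I_q * 'I_d * 'I_d with
      | inl (i, j) => V0 i j
      | inr (a, i, j) => P0 (val a) i j
      end.
    have Vu : V u = V0 by apply/matrixP => i j; rewrite !mxE enum_rankK.
    have Pu a : (a < q)%N -> P u a = P0 a.
      move=> aq; apply/matrixP => i j; rewrite -[a]/(val (Ordinal aq)) PE.
      by rewrite mxE enum_rankK.
    have a'q a : (a < q)%N -> (a.+1 %% q < q)%N.
      by move=> aq; rewrite ltn_mod (leq_ltn_trans _ aq).
    exists u => //; apply/KP; case: (PR) => Ph Pm P1; split.
    - by rewrite Vu.
    - split=> [a aq|a b aq bq|]; first by rewrite Pu // Ph.
        by rewrite !Pu // Pm.
      by rewrite -P1; apply: eq_bigr => a _; rewrite Pu.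
    - by move=> a aq; rewrite Vu !Pu ?a'q // sV.
    - by move=> a aq; rewrite Pu // (resolution_rank PR) // rk.
  split=> //; exists (P u); split=> // a aq.
  by apply/eqP; rewrite -(eqr_nat C) -(resolution_rank PR) // tr.
apply: compact_closed; first exact: norm_hausdorff.
apply: continuous_compact => //; apply: continuous_subspaceT.
exact: entrywise_continuousW.
Qed.

End FamilySet.

(** * Rigidity of the period *)

Section Rigidity.
Variables (R : realType) (d k : nat).
Local Notation C := (Cplx R).
Implicit Types (V A : 'M[C]_(d * k, d)) (X W Z : 'M[C]_d) (z w c : C).
Implicit Types (P : nat -> 'M[C]_d).

(** As the channel maps P_(a+1) to P_a, a vanishing projection makes all lower ones vanish, then the
    last one by wrapping around, then all, although their sum is 1. *)
Lemma decomposition_neq0 V P a : Virr_set V -> periodic_decomposition V P ->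
  (a < period V)%N -> P a != 0.
Proof.
move=> Virr dP ap; apply/eqP => Pa.
have [_ _ P1 TP _] := dP; have p0 := period_gt0 Virr.
have down n : (n < period V)%N -> P n = 0 -> forall m, (m <= n)%N -> P m = 0.
  elim: n => [|n IH] np Pn m; first by rewrite leqn0 => /eqP ->.
  rewrite leq_eqVlt => /predU1P[-> //|mn]; apply: IH => //; first exact: ltnW.
  by rewrite -TP ?(ltnW np) // modn_small // Pn linear0.
have P0 : P 0 = 0 by apply: (down a).
have Plast : P (period V).-1 = 0.
  by rewrite -TP ?prednK // modnn P0 linear0.
have d0 := irr_dim_gt0 Virr.
have : (1%:M : 'M[C]_d) = 0.
  rewrite -P1 big1 // => b _; apply: (down (period V).-1) => //.
    by rewrite prednK.
  by rewrite -ltnS prednK.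
by move/eqP; rewrite -mxrank_eq0 mxrank1 -leqn0 leqNgt d0.
Qed.

(* For k = 1 the channel is X |-> U^* X U with U unitary; U itself is a fixed
   point, so it is scalar and every X is fixed. *)
Lemma period_dim1 V : Virr_set V -> k = 1%N -> period V = 1%N.
Proof.
move=> Virr k1; have p0 := period_gt0 Virr; have V1 := Virr.1.
have l0 : (0 < k)%N by rewrite k1.
pose i0 : 'I_k := Ordinal l0.
have ord_k (l : 'I_k) : l = i0.
  by apply: val_inj; case: l => l /=; rewrite k1 ltnS leqn0 => /eqP.
pose U : 'M[C]_d := \matrix_(i, j) V (mxtens_index (i, i0)) j.
have cov X : X *m U = U *m X -> covariant V 1 X.
  move=> XU; apply/matrixP => x j; case: (mxtens_indexP x) => i l.
  rewrite (ord_k l) mul_ampl_mx mxE mul1r.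
  have /matrixP/(_ i j) := XU; rewrite !mxE.
  under eq_bigr do rewrite mxE.
  by under [in RHS]eq_bigr do rewrite mxE.
have fixed X : covariant V 1 X -> exists c, X = c%:M.
  move=> cX; apply: (fixed_point_scalar Virr).
  by rewrite (covariant_channel V1 cX) scale1r.
have [u Uu] := fixed U (cov U erefl).
have scal X : exists c, X = c%:M.
  by apply/fixed/cov; rewrite Uu mul_mx_scalar mul_scalar_mx.
apply/eqP; rewrite eqn_leq p0 andbT leqNgt; apply/negP => p1.
have [P dP] := irr_has_decomposition Virr.
have [a Pa] := scal (P 0%N); have [b Pb] := scal (P 1%N).
have [_ P01 _ _ _] := dP.
have := P01 0%N 1%N p0 p1 isT; rewrite Pa Pb mul_scalar_mx => /eqP.
rewrite scaler_eq0 => /orP[/eqP a0|/eqP Pb0].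
  by have := decomposition_neq0 Virr dP p0; rewrite Pa a0 raddf0 eqxx.
by have := decomposition_neq0 Virr dP p1; rewrite Pb Pb0 eqxx.
Qed.

(** Otherwise V V^* = 1, so dk <= d, which forces k = 1 and period 1. *)
Lemma exists_free_direction V P : Virr_set V ->
  periodic_decomposition V P -> period V <> 1%N ->
  exists2 x, (x < period V)%N &
    (1%:M - V *m V^t*) *m ampl k (P (x.+1 %% period V)%N) != 0.
Proof.
move=> Virr dP p1; apply: contrapT => none; apply: p1; apply: period_dim1 => //.
have V1 := Virr.1; have d0 := irr_dim_gt0 Virr.
have [_ _ P1 _ _] := dP.
have Q0 : 1%:M - V *m V^t* = 0.
  have I1 : 1%:M = \sum_(x < period V) ampl k (P (x.+1 %% period V)%N).
    by rewrite -ampl1 -P1 -(sum_shift (period V) P) linear_sum.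
  rewrite -[LHS]mulmx1 [X in _ *m X]I1.
  rewrite mulmx_sumr big1 // => x _ /=; apply/eqP; apply: contrapT => /negP nz.
  by apply: none; exists (val x); [exact: ltn_ord | exact: nz].
have := mxrankM_maxl V (V^t*); rewrite -(subr0_eq Q0) mxrank1.
move=> /leq_trans/(_ (rank_leq_col V)); rewrite -{2}(muln1 d) leq_pmul2l //.
by have := isometry_dim V1 d0; case: k => [|[|]].
Qed.

Lemma mul_mx_neq0 m n p q (L : 'M[C]_(p, m)) (X : 'M[C]_(n, q)) :
  L != 0 -> X != 0 -> exists B, L *m B *m X != 0.
Proof.
move=> /matrix0Pn[i' [i Li]] /matrix0Pn[j [j' Xj]].
exists (delta_mx i j); apply/matrix0Pn; exists i', j'.
by rewrite mul_mx_delta_mx mulf_neq0.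
Qed.

Lemma family_dim_eq q (r r' : nat -> nat) : (0 < q)%N ->
  (forall a, (a < q)%N -> r a = r' a) -> family_dim k q r = family_dim k q r'.
Proof.
move=> q0 rr; apply: eq_bigr => a _.
by rewrite (rr a) // (rr _) // ltn_mod.
Qed.

(* If q were a proper divisor of the period, the operators intertwined by the
   coarser family would have a larger dimension than the fixed ones. *)
Lemma same_dim_period V P q (P' : nat -> 'M[C]_d) l : Virr_set V ->
  periodic_decomposition V P -> has_real_dim (fixed_subspace V) l ->
  (0 < q)%N -> resolution q P' -> shifts q P' V ->
  has_real_dim (shift_intertwiners q P' V) l -> q = period V.
Proof.
move=> Virr dP fix_l q0 PR' sV' fam_l.
have sub := fixed_sub_intertwiners q0 PR' sV'.
(* An inclusion between spaces of equal dimension is an equality. *)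
have famE := (real_dim_sub fix_l fam_l sub).2 erefl.
have p0 := period_gt0 Virr; have gp := gamma_prim R p0.
have gq := gamma_prim R q0; have gq1 := norm_gamma R q.
have uZ' := wsum_unitary PR' gq1.
have cZ' := shifts_covariant (prim_expr_order gq) sV'.
have [j [s [eg eZ']]] := covariant_unique Virr dP gq1 uZ' cZ'.
have gqp : gamma R q ^+ period V = 1.
  by rewrite eg exprAC (prim_expr_order gp) expr1n.
have q_dvd : (q %| period V)%N by rewrite (prim_order_dvd gq) gqp.
have [p1|/eqP p1] := eqVneq (period V) 1%N.
  by move: q_dvd; rewrite p1 dvdn1 => /eqP.
apply/eqP; rewrite eqn_dvd q_dvd /=.
have PR := decomposition_resolution dP.
have sV := decomposition_shifts Virr.1 dP.
have [Ph Pm _] := PR.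
have [x xp Lx] := exists_free_direction Virr dP p1.
(* The q-th roots of unity do not separate y from x, and y = x only if the period divides q. *)
pose y := ((x + q) %% period V)%N.
have yp : (y < period V)%N by rewrite ltn_mod.
have gy : gamma R q ^+ y = gamma R q ^+ x.
  by rewrite /y expr_mod // exprD (prim_expr_order gq) mulr1.
suff yx : y = x.
  have : (x + q == x %[mod period V])%N.
    by rewrite (modn_small xp) -[X in _ == X]yx.
  by rewrite -{2}(addn0 x) eqn_modDl mod0n.
apply: contrapT => /eqP xy.
have mod_lt a : (a < period V)%N -> (a.+1 %% period V < period V)%N.
  by rewrite ltn_mod.
move: Lx; set L := _ *m _ => Lx.
have QE : L = ampl k (P (x.+1 %% period V)%N) *m (1%:M - V *m V^t*).
  rewrite /L mulmxBr mulmxBl mulmx1 mul1mx.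
  by have [-> ->] := shifts_range_comm PR sV xp.
have PL b : (b < period V)%N ->
    ampl k (P b) *m L = (b == x.+1 %% period V)%N%:R *: L.
  move=> bp; rewrite QE mulmxA -amplM (Pm _ _ bp (mod_lt x xp)).
  have [->|_] := eqVneq b _; first by rewrite !scale1r.
  by rewrite !scale0r linear0 mul0mx.
have VL : V *m V^t* *m L = 0.
  rewrite /L mulmxA mulmxBr mulmx1 mulmxA -(mulmxA V _ V) [V^t* *m V]Virr.1.
  by rewrite mulmx1 subrr mul0mx.
clear QE; clearbody L.
(* The nonzero operator L B P_y maps the component y into the component x + 1. It respects the
   coarse family, but the fine one only if y = x. *)
have [B LB] := mul_mx_neq0 Lx (decomposition_neq0 Virr dP yp).
have PA b : (b < period V)%N ->
    ampl k (P b) *m (L *m B *m P y) =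
    (b == x.+1 %% period V)%N%:R *: (L *m B *m P y).
  by move=> bp; rewrite !mulmxA (PL b bp) -!scalemxAl.
have AP : L *m B *m P y *m P y = L *m B *m P y.
  by rewrite -mulmxA (Pm _ _ yp yp) eqxx scale1r.
have [A eA] : exists A, A = L *m B *m P y by eexists.
rewrite -!eA in LB PA AP; move: LB PA AP => A0 PA AP.
have TA : Tid V A.
  by rewrite /Tid /= eA !mulmxA VL !mul0mx.
have cA : covariant A (gamma R q) (wsum q P' (gamma R q)).
  rewrite eZ' /covariant linearZ /= -scalemxAl -scalemxAr -eg.
  rewrite scalerA [gamma R q * s]mulrC -scalerA; congr (_ *: _).
  have -> : A *m wsum (period V) P (gamma R q) = gamma R q ^+ y *: A.
    by rewrite -{1}AP -mulmxA (wsum_mull PR _ yp) -scalemxAr AP.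
  have -> : ampl k (wsum (period V) P (gamma R q)) *m A =
            gamma R q ^+ x.+1 *: A.
    rewrite linear_sum mulmx_suml (bigD1 (Ordinal (mod_lt x xp))) //=.
    rewrite linearZ /= -scalemxAl (PA _ (mod_lt x xp)) eqxx scale1r expr_mod //.
    rewrite big1 ?addr0 // => b; rewrite -val_eqE /= => /negPf bx.
    by rewrite linearZ /= -scalemxAl (PA b) // bx scale0r scaler0.
  by rewrite gy scalerA -exprS.
have fA : fixed_subspace V A.
  by apply: famE; split=> //; exact: (covariant_shifts PR' gq cA).
move: fA; rewrite (fixed_subspaceE Virr dP) => -[_ sA].
have := sA y yp; rewrite AP (PA _ (mod_lt y yp)) shift_eq // (negPf xy) scale0r.
by move/eqP; rewrite (negPf A0).
Qed.

(** The unitaries of both families are eigenvectors for the same simple eigenvalue, hence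
    proportional; the factor is a power of gamma and shifts the labels of the spectral
    projections. *)
Lemma same_period_shift V P (P' : nat -> 'M[C]_d) : Virr_set V ->
  periodic_decomposition V P -> resolution (period V) P' ->
  shifts (period V) P' V ->
  exists s, forall a, (a < period V)%N -> P a = P' ((a + s) %% period V)%N.
Proof.
move=> Virr dP PR' sV'; have p0 := period_gt0 Virr.
have gp := gamma_prim R p0; have gp1 := prim_expr_order gp.
have PR := decomposition_resolution dP.
have sV := decomposition_shifts Virr.1 dP.
have P0 := decomposition_neq0 Virr dP p0.
move: (period V) P0 p0 gp gp1 PR sV PR' sV'.
move=> p P0 p0 gp gp1 PR sV PR' sV'.
have g1 := norm_gamma R p.
have uZ := wsum_unitary PR g1; have cZ := shifts_covariant gp1 sV.
have cZ' := shifts_covariant gp1 sV'.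
have [s eZ] := peripheral_simple Virr g1 uZ cZ cZ'.
have eqn a b : (a < p)%N -> (b < p)%N -> P' b *m P a != 0 ->
    gamma R p ^+ b = s * gamma R p ^+ a.
  move=> ap bp; apply: contraNeq => ne.
  have : P' b *m wsum p P' (gamma R p) *m P a =
         P' b *m (s *: wsum p P (gamma R p)) *m P a by rewrite eZ.
  rewrite (wsum_mull PR' _ bp) -scalemxAr -!scalemxAl -mulmxA.
  rewrite (wsum_mulr PR _ ap).
  rewrite -scalemxAr scalerA => /eqP; rewrite -subr_eq0 -scalerBl scaler_eq0.
  by rewrite subr_eq0 (negPf ne).
have [_ _ P1'] := PR'; have [_ _ P1] := PR.
(* P_0 is nonzero, so some P'_b meets it, and this b identifies the factor s as gamma^b. *)
have [b0 b0p nz] : exists2 b, (b < p)%N & P' b *m P 0%N != 0.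
  apply: contrapT => none; move/eqP: P0; apply.
  rewrite -[LHS]mul1mx -P1' mulmx_suml big1 // => b _.
  apply/eqP; apply: contrapT => /negP bnz; apply: none.
  by exists (val b); [exact: ltn_ord | exact: bnz].
have es := eqn _ _ p0 b0p nz; rewrite expr0 mulr1 in es.
have off a b : (a < p)%N -> (b < p)%N -> b != ((a + b0) %% p)%N ->
    P' b *m P a = 0.
  move=> ap bp; apply: contraNeq => /(eqn _ _ ap bp).
  rewrite -es -exprD addnC => /eqP; rewrite (eq_prim_root_expr gp).
  by rewrite (modn_small bp).
exists b0 => a ap.
have a'p : ((a + b0) %% p < p)%N by rewrite ltn_mod.
transitivity (P' ((a + b0) %% p)%N *m P a).
  rewrite -[LHS]mul1mx -P1' mulmx_suml (bigD1 (Ordinal a'p)) //= big1 ?addr0 //.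
  by move=> b ba; apply: off.
rewrite -[RHS]mulmx1 -P1 mulmx_sumr (bigD1 (Ordinal ap)) //= big1 ?addr0 //.
move=> b; rewrite -val_eqE /= => ba; apply: off => //.
by rewrite eqn_modDr !modn_small // eq_sym.
Qed.

Lemma family_rigid V P q r l : Virr_set V -> periodic_decomposition V P ->
  has_real_dim (fixed_subspace V) l -> (0 < q)%N ->
  l%:Z = 2 * family_dim k q r -> family_set q r V ->
  q = period V /\ exists s, forall a, (a < q)%N ->
    \rank (P a) = r ((a + s) %% q)%N.
Proof.
move=> Virr dP fix_l q0 el [V1 [P' [PR' sV' rk]]].
have [m [em fam_m]] := shift_intertwiners_dim V1 PR' sV'.
have lm : l = (m + m)%N.
  apply/eqP; rewrite -eqz_nat el -(family_dim_eq q0 rk) -em PoszD.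
  by rewrite mulr_natl mulr2n.
rewrite -lm in fam_m.
have qp := same_dim_period Virr dP fix_l q0 PR' sV' fam_m.
split=> //; move: PR' sV' rk; rewrite qp => PR' sV' rk.
have [s sP] := same_period_shift Virr dP PR' sV'.
exists s => a ap; rewrite sP // rk // ltn_mod.
exact: period_gt0.
Qed.

Lemma fixed_dim_family V P l : Virr_set V -> periodic_decomposition V P ->
  has_real_dim (fixed_subspace V) l ->
  l%:Z = 2 * family_dim k (period V) (fun a => \rank (P a)).
Proof.
move=> Virr dP fix_l.
have [m [<- fam_m]] := shift_intertwiners_dim Virr.1
  (decomposition_resolution dP) (decomposition_shifts Virr.1 dP).
rewrite (fixed_subspaceE Virr dP) in fix_l.
by rewrite (real_dim_inj fix_l fam_m) PoszD mulr_natl mulr2n.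
Qed.

Lemma resolution_shift q P s : (0 < q)%N -> resolution q P ->
  resolution q (fun a => P ((a + s) %% q)%N).
Proof.
move=> q0 [Ph Pm P1]; split=> [a _|a b aq bq|].
- by rewrite Ph // ltn_mod.
- by rewrite Pm ?ltn_mod // eqn_modDr (modn_small aq) (modn_small bq).
elim: s => [|s IH].
  by rewrite -P1; apply: eq_bigr => a _; rewrite addn0 (modn_small (ltn_ord a)).
rewrite -IH -[in RHS](sum_shift q (fun a => P ((a + s) %% q)%N)).
by apply: eq_bigr => a _; rewrite modnDml addSnnS.
Qed.

Lemma shifts_shift q P s V : (0 < q)%N -> shifts q P V ->
  shifts q (fun a => P ((a + s) %% q)%N) V.
Proof.
move=> q0 sV a aq.
have e : (((a + s) %% q).+1 %% q = (a.+1 %% q + s) %% q)%N.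
  by rewrite -(addn1 ((a + s) %% q)) modnDml addn1 -addSn modnDml.
by rewrite (sV _ (ltn_pmod _ q0)) e.
Qed.

(** Adding s (q - 1) subtracts s modulo q while staying in the naturals. *)
Lemma modn_shiftK q s a : (a < q)%N -> (((a + s * q.-1) %% q + s) %% q)%N = a.
Proof.
move=> aq; rewrite modnDml -addnA -[X in (_ * _ + X)%N]muln1 -mulnDr addn1.
by rewrite prednK ?(leq_ltn_trans _ aq) // addnC modnMDl modn_small.
Qed.

Lemma family_set_gact c W q r V : `|c| = 1 -> W \is unitarymx ->
  family_set q r V -> family_set q r (gact c W V).
Proof.
move=> c1 uW [V1 [P [[Ph Pm P1] sV rk]]].
have W1 := unitarymx_adjl uW; have W1' := unitarymxP uW.
have aW1 : ampl k (W^t*) *m ampl k W = 1%:M by rewrite -amplM W1 ampl1.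
split.
  rewrite /is_isometry /gact adjmxZ conjCK -scalemxAl -scalemxAr scalerA.
  rewrite -normCK c1 expr1n scale1r !adjmxM trmxCK ampl_adj.
  rewrite !mulmxA -(mulmxA _ (ampl k (W^t*)) (ampl k W)) aW1 mulmx1.
  by rewrite -(mulmxA W) [V^t* *m V]V1 mulmx1.
exists (fun a => W *m P a *m W^t*); split.
- split=> [a aq|a b aq bq|].
  + by rewrite !adjmxM trmxCK Ph // mulmxA.
  + rewrite !mulmxA -(mulmxA _ (W^t*) W) W1 mulmx1 -(mulmxA W (P a)).
    by rewrite (Pm a b aq bq) -scalemxAr -scalemxAl.
  + by rewrite -mulmx_suml -mulmx_sumr P1 mulmx1.
- move=> a aq; rewrite /gact -scalemxAl -scalemxAr; congr (_ *: _).
  rewrite !mulmxA -(mulmxA _ (W^t*) W) W1 mulmx1 -(mulmxA _ V) (sV a aq).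
  rewrite !amplM !mulmxA -(mulmxA _ (ampl k (W^t*)) (ampl k W)) aW1 mulmx1.
  by [].
- move=> a aq; rewrite -rk // mxrankMfree; last first.
    by rewrite row_free_unit; apply: unitarymx_unit; rewrite trmxC_unitary.
  by rewrite eqmxMfull // row_full_unit unitarymx_unit.
Qed.

Lemma has_real_dim_gact c W V n : `|c| = 1 -> W \is unitarymx ->
  has_real_dim (fixed_subspace V) n ->
  has_real_dim (fixed_subspace (gact c W V)) n.
Proof.
move=> c1 uW [b [bS bfree]].
have c1' : `|c^*| = 1 by rewrite norm_conjC.
have uW' : W^t* \is unitarymx by rewrite trmxC_unitary.
have gK := gact_cancel (k := k) c1 uW.
have gK' A : gact c W (gact c^* (W^t*) A) = A.
  by have := gact_cancel c1' uW' A; rewrite conjCK trmxCK.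
have glin (x : 'I_n -> R) : \sum_i (x i)%:C%C *: gact c W (b i) =
    gact c W (\sum_i (x i)%:C%C *: b i).
  rewrite /gact mulmx_sumr mulmx_suml scaler_sumr; apply: eq_bigr => i _.
  by rewrite -scalemxAr -scalemxAl !scalerA mulrC.
exists (fun i => gact c W (b i)); split=> [A|x].
  split=> [fA|[x ->]].
    have := fixed_subspace_gact c1' uW' fA; rewrite gK => /bS[x ex].
    by exists x; rewrite glin -ex gK'.
  by rewrite glin; apply: fixed_subspace_gact => //; apply/bS; exists x.
rewrite glin => /(congr1 (gact c^* (W^t*))); rewrite gK => e.
by apply: bfree; rewrite e /gact mulmx0 mul0mx scaler0.
Qed.

End Rigidity.

(** * Strata *)

Section Strata.
Variables (R : realType) (d k : nat).
Local Notation C := (Cplx R).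
Implicit Types (u v w : Virr R d k) (P Q : nat -> 'M[C]_d).

Lemma mx_of_irr v : Virr_set (mx_of v).
Proof. exact: set_mem (valP v). Qed.

Lemma cls_surj (x : Pirr R d k) : exists v, x = cls v.
Proof.
by exists (repr (x : {eq_quot orbit_equiv R d k})); rewrite /cls reprK.
Qed.

Definition family_class q r : set (Pirr R d k) :=
  [set cls v | v in [set v | family_set q r (mx_of v)]].

Lemma family_classP q r v :
  family_class q r (cls v) <-> family_set q r (mx_of v).
Proof.
split=> [[w /= Fw /cls_eq[c [W [c1 uW ->]]]]|Fv]; last by exists v.
exact: family_set_gact.
Qed.

(** [family_set] is a union of orbits within the irreducible isometries, so the preimage of the
    class set under the quotient map is the closed set itself. *)
Lemma family_class_closed q r : closed (family_class q r).
Proof.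
rewrite -openC; have cF : closed (@mx_of R d k @^-1` family_set q r).
  apply: preimage_closed; last exact: family_set_closed.
  by move=> v _; exact: initial_continuous.
have E : \pi_({eq_quot orbit_equiv R d k}) @^-1` (~` family_class q r) =
         ~` (@mx_of R d k @^-1` family_set q r).
  apply/predeqP => v; split=> nF F; apply: nF; first exact/family_classP.
  exact/(family_classP q r v).
by rewrite /open /= /quotient_open E openC.
Qed.

Lemma singular_manifold_dim l v : singular_manifold l (cls v) ->
  has_real_dim (fixed_subspace (mx_of v)) l.
Proof.
case=> p _ [[w /= [_ dimw] /cls_eq[c [W [c1 uW ->]]]] _].
exact: has_real_dim_gact.
Qed.

Lemma decomposition_family_set V P : Virr_set V ->
  periodic_decomposition V P ->
  @family_set R d k (period V) (fun a => \rank (P a)) V.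
Proof.
move=> Virr dP; split; first exact: Virr.1.
exists P; split=> //; first exact: decomposition_resolution.
exact: decomposition_shifts Virr.1 dP.
Qed.

(** The ranks are positive and sum to d. Thus only finitely many periods and dimensions can
    occur. *)
Lemma period_le_dim (V : 'M[C]_(d * k, d)) : Virr_set V -> (period V <= d)%N.
Proof.
move=> Virr; have [P dP] := irr_has_decomposition Virr.
have PR := decomposition_resolution dP; have [_ _ P1] := PR.
have : (\sum_(a < period V) \rank (P a))%N = d.
  apply/eqP; rewrite -(eqr_nat C) natr_sum -(mxtrace1 C d) -P1 linear_sum.
  by apply/eqP/eq_bigr => a _; rewrite -(resolution_rank PR).
move=> {2}<-; rewrite -[leqLHS]card_ord -sum1_card; apply: leq_sum => a _.
by rewrite lt0n mxrank_eq0 (decomposition_neq0 Virr dP).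
Qed.

(* The classes in the stratum with given period and dimensions form a
   relatively closed set, and only finitely many values occur, so these sets
   are also relatively open. *)
Lemma component_rigid l v w P Q :
  connected_component (@singular_manifold R d k l) (cls v) (cls w) ->
  periodic_decomposition (mx_of v) P -> periodic_decomposition (mx_of w) Q ->
  period (mx_of v) = period (mx_of w) /\
  exists s : nat, forall a : nat, (a < period (mx_of v))%N ->
    \rank (P a) = \rank (Q ((a + s) %% period (mx_of w))%N).
Proof.
case=> S [Sv Ssing Sconn] Sw dP dQ.
have virr := mx_of_irr v; have p0 := period_gt0 virr.
have Fv := decomposition_family_set virr dP.
have dim_v := fixed_dim_family virr dP (singular_manifold_dim (Ssing _ Sv)).
move: (period (mx_of v)) p0 Fv dim_v => p p0.
set r := (fun a => \rank (P a)) => Fv dim_v.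
pose I : finType := ('I_d.+1 * {ffun 'I_d.+1 -> 'I_d.+1})%type.
pose rr (i : I) (a : nat) : nat := i.2 (inord a).
(* The data compatible with the dimension l that are not a cyclic shift of (p, r). *)
pose other : set I := [set i : I | [/\ (0 < i.1)%N,
  l%:Z = 2 * family_dim k i.1 (rr i) &
  ~ (nat_of_ord i.1 = p /\
     exists e, forall a, (a < p)%N -> r a = rr i ((a + e) %% p)%N)]].
pose E := \bigcup_(i in other) family_class i.1 (rr i).
have Eclosed : closed E.
  apply: closed_bigcup => [|i _]; last exact: family_class_closed.
  exact: finite_finset.
have cover x : S x -> ~ family_class p r x -> E x.
  have [u ->] := cls_surj x; move=> Su nF.
  have uirr := mx_of_irr u; have [Pu dPu] := irr_has_decomposition uirr.
  have q0 := period_gt0 uirr; have qd := period_le_dim uirr.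
  have Fu := decomposition_family_set uirr dPu.
  have dim_u := fixed_dim_family uirr dPu (singular_manifold_dim (Ssing _ Su)).
  move: (period (mx_of u)) q0 qd Fu dim_u => q q0 qd Fu dim_u.
  (* Nothing is truncated by [inord]: the period and the ranks are at most d. *)
  pose i : I := (inord q, [ffun b : 'I_d.+1 => inord (\rank (Pu b))]).
  have i1 : nat_of_ord i.1 = q by rewrite /= inordK.
  have ri a : (a < q)%N -> \rank (Pu a) = rr i a.
    move=> aq; have ad : (a < d.+1)%N by rewrite ltnS (leq_trans (ltnW aq)).
    by rewrite /rr /= ffunE (inordK ad) inordK // ltnS rank_leq_row.
  have [V1 [P' [PR' sV' rk]]] := Fu.
  exists i; rewrite /other /= -/i.1 i1.
    split=> //; first by rewrite -(family_dim_eq k q0 ri).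
    case=> qp [e re]; apply: nF; apply/family_classP; split=> //.
    exists (fun a => P' ((a + e) %% q)%N); rewrite -qp; split.
    - exact: resolution_shift.
    - exact: shifts_shift.
    - by move=> a aq; rewrite rk ?ltn_mod // ri ?ltn_mod // re -?qp.
  apply/family_classP; split=> //; exists P'; split=> // a aq.
  by rewrite rk // ri.
have disjoint x : S x -> family_class p r x -> E x -> False.
  have [u ->] := cls_surj x; move=> Su /family_classP Fu.
  case=> i [i0 dim_i no] /family_classP Fi; apply: no.
  have uirr := mx_of_irr u; have [Pu dPu] := irr_has_decomposition uirr.
  have fix_u := singular_manifold_dim (Ssing _ Su).
  have [pu [s rs]] := family_rigid uirr dPu fix_u p0 dim_v Fu.
  have [iu [t rt]] := family_rigid uirr dPu fix_u i0 dim_i Fi.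
  have ip : nat_of_ord i.1 = p by rewrite iu pu.
  (* This stands for t - s modulo p. *)
  split=> //; exists (s * p.-1 + t)%N => a ap.
  rewrite -{1}(modn_shiftK s ap) -rs ?ltn_mod // rt ip ?ltn_mod //.
  by rewrite modnDml addnA.
(* On S this class set is closed and is the complement of the closed set [E]; being nonempty, it is
   all of the connected set S. *)
have SF : S `&` family_class p r = S.
  apply: Sconn; first by exists (cls v); split=> //; exact/family_classP.
    exists (~` E); first by rewrite openC.
    apply/predeqP => x; split=> -[Sx h]; split=> //.
      by move=> Ex; exact: disjoint h Ex.
    by apply: contrapT => nF; apply: h; exact: cover.
  by exists (family_class p r) => //; exact: family_class_closed.
have : (S `&` family_class p r) (cls w) by rewrite SF.
case=> _ /family_classP Fw.
have [pw [s rs]] := family_rigid (mx_of_irr w) dQ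
  (singular_manifold_dim (Ssing _ Sw)) p0 dim_v Fw.
split=> //; exists (s * p.-1)%N => a ap; rewrite -pw rs ?ltn_mod //.
by rewrite modn_shiftK.
Qed.

End Strata.

Theorem proposition5 (R : realType) (d k : nat) :
  (forall (v : Virr R d k) (P : nat -> 'M[Cplx R]_d),
     periodic_decomposition (mx_of v) P ->
     exists l : nat,
       [/\ l%:Z = 2 * \sum_(a < period (mx_of v))
             ((\rank (P (a.+1 %% period (mx_of v))%N))%:Z * k%:Z
                - (\rank (P a))%:Z) * (\rank (P a))%:Z,
           orbit_type_stratum (period (mx_of v)) l (cls v)
           /\ (period (mx_of v) <> 1%N ->
               singular_stratum (period (mx_of v)) l (cls v)),
           (l <= 2 * d ^ 2 * (k - 1))%N
           /\ has_real_dim (Tid (mx_of v)) (2 * d ^ 2 * (k - 1))%N &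
           forall (w : Virr R d k) (Q : nat -> 'M[Cplx R]_d),
             cls w = cls v -> periodic_decomposition (mx_of w) Q ->
             real_linear_iso (tangent_space (cls v)) (intertwiners (mx_of w) Q)
             /\ fixed_subspace (mx_of w) = intertwiners (mx_of w) Q])
  /\
  (forall (l : nat) (v w : Virr R d k),
     connected_component (@singular_manifold R d k l) (cls v) (cls w) ->
     period (mx_of v) = period (mx_of w) /\
     forall P Q : nat -> 'M[Cplx R]_d,
       periodic_decomposition (mx_of v) P -> periodic_decomposition (mx_of w) Q ->
       exists s : nat, forall a : nat, (a < period (mx_of v))%N ->
         \rank (P a) = \rank (Q ((a + s) %% period (mx_of w))%N)).
Proof.
split=> [v P dP|l v w vw]; last first.
  have [P dP] := irr_has_decomposition (mx_of_irr v).
  have [Q dQ] := irr_has_decomposition (mx_of_irr w).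
  split; first by have [] := component_rigid vw dP dQ.
  by move=> P' Q' dP' dQ'; have [] := component_rigid vw dP' dQ'.
have virr := mx_of_irr v; have V1 := virr.1.
have [m [em dim_m]] := shift_intertwiners_dim V1 (decomposition_resolution dP)
  (decomposition_shifts V1 dP).
have fixE := fixed_subspaceE virr dP.
have dim_fix : has_real_dim (fixed_subspace (mx_of v)) (m + m) by rewrite fixE.
have stratum : orbit_type_stratum (period (mx_of v)) (m + m) (cls v).
  by exists v => //; split=> //; exact: stabiliser_decomposition dP.
(* The complex dimension is m, and the singular dimension is real. *)
exists (m + m)%N; split.
- rewrite -[RHS]/(2 * family_dim k (period (mx_of v)) (fun a => \rank (P a))).
  by rewrite -em PoszD mulr_natl mulr2n.
- split; first exact: stratum.
  move=> p1; split; first exact: stratum.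
  (* The period is constant on orbits, so no representative is primitive. *)
  move=> [w /= w1 /cls_eq/orbit_period wv].
  by apply: p1; rewrite -wv.
- split; last exact: Tid_dim.
  by apply: (real_dim_sub dim_fix (Tid_dim virr) _).1 => A [].
(* The representative chosen by the quotient lies in the orbit of w, and the group element relating
   them carries fixed vectors to fixed vectors. *)
- move=> w Q wv dQ; have wirr := mx_of_irr w.
  rewrite -(fixed_subspaceE wirr dQ); split=> //.
  apply: orbit_fixed_iso; apply/cls_eq.
  by rewrite wv /cls reprK.
Qed.
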